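(* Let $\lambda\in\Gamma$ be a composition of $r$ and let $K_0^\lambda\subseteq C_0^\lambda=\mathrm{Hom}_R(M^\lambda,R)$ be the $R$-span of the elements $\varepsilon_t$, where $t$ runs through the set $\mathcal{T}^{\mathrm{st}}(\lambda)$ of standard $\lambda$-tableaux. Then $$\mathrm{im}(d_1^\lambda)+K_0^\lambda=C_0^\lambda\qquad\text{and}\qquad\ker(d_0^\lambda)\cap K_0^\lambda=\{0\}.$$ In particular, the chain complex $\widetilde{C}_*^\lambda$ is exact in degree $0$, i.e. $\mathrm{im}(d_1^\lambda)=\ker(d_0^\lambda)$, for every composition $\lambda\in\Gamma$.
   Context: Hecke algebra. $R$ is an integral domain, $q\in R$ a unit, $r$ a positive integer. $W$ is the symmetric group on $\{1,\ldots,r\}$, acting from the right (so $i(vw)=(iv)w$), $S=\{(i,i+1)\mid 1\le i\le r-1\}$, and $l$ is the length function with respect to $S$. $\mathcal{H}$ is the $R$-algebra with $R$-basis $T_w$ ($w\in W$), identity $T_1$, and multiplication determined, for $w\in W$, $s\in S$, by $T_wT_s=T_{ws}$ if $l(ws)=l(w)+1$ and $T_wT_s=qT_{ws}+(q-1)T_w$ if $l(ws)=l(w)-1$. Unadorned $\otimes$ is over $R$. Compositions. $\Gamma$ is the set of compositions $\lambda=(\lambda_1,\lambda_2,\ldots)$ of $r$ (sequences of non-negative integers with sum $r$), $\Lambda\subseteq\Gamma$ the set of partitions (weakly decreasing compositions). For $\lambda,\mu\in\Gamma$, $\lambda\trianglelefteq\mu$ means $\sum_{i=1}^e\lambda_i\le\sum_{i=1}^e\mu_i$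 for all $e\ge1$; $\lambda\triangleleft\mu$ means $\lambda\trianglelefteq\mu$ and $\lambda\ne\mu$. For $\lambda\in\Lambda$, $\lambda'$ is the conjugate partition. Permutation modules. For $\lambda\in\Gamma$ let $P_i=P_i^\lambda=\{\lambda_1+\cdots+\lambda_{i-1}+1,\ldots,\lambda_1+\cdots+\lambda_i\}$ and let $W_\lambda$ be the subgroup of all $w\in W$ with $P_iw=P_i$ for all $i$. Put $x_\lambda=\sum_{w\in W_\lambda}T_w$ and $M^\lambda=x_\lambda\mathcal{H}$ (a right $\mathcal{H}$-module). $\mathcal{D}_\lambda$ is the set of the unique shortest elements of the cosets $W_\lambda w$; the elements $x_\lambda T_d$ ($d\in\mathcal{D}_\lambda$) form an $R$-basis of $M^\lambda$. Tableaux. A $\lambda$-tableau is a bijective filling of the Young diagram of $\lambda$ ($\lambda_i$ boxes in row $i$) with $1,\ldots,r$; $W$ acts on tableaux from the right by acting on the entries. $t^\lambda$ is the $\lambda$-tableau with entries $1,\ldots,r$ in order along the rows, from the first row downwards. A tableau is row-standard if its entries increase along each row from left to right; $\mathcal{T}^{\mathrm{rs}}(\lambda)$ is the set of row-standard $\lambda$-tableaux. The map $\mathcal{D}_\lambda\to\mathcal{T}^{\mathrm{rs}}(\lambda)$, $d\mapsto t^\lambda d$, is a bijection. If $\lambda\in\Lambda$, $\mathcal{T}^{\mathrm{st}}(\lambda)$ is the set of standard $\lambda$-tableaux (entries increasing along rows and down columns); if $\lambda$ is not a partition, $\mathcal{T}^{\mathrm{st}}(\lambda)=\emptyset$. For $t=t^\lambda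 d\in\mathcal{T}^{\mathrm{rs}}(\lambda)$ with $d\in\mathcal{D}_\lambda$, $\varepsilon_t=\varepsilon_d\in\mathrm{Hom}_R(M^\lambda,R)$ is the dual basis element, $\varepsilon_d(x_\lambda T_e)=\delta_{d,e}$ for $e\in\mathcal{D}_\lambda$. Specht modules. For $\lambda\in\Lambda$, $w_\lambda\in W$ is defined by the property that the transpose of $t^\lambda w_\lambda$ is $t^{\lambda'}$; $y_\lambda=\sum_{w\in W_\lambda}(-q)^{-l(w)}T_w$, $z_\lambda=x_\lambda T_{w_\lambda}y_{\lambda'}$, and $S^\lambda=z_\lambda\mathcal{H}\subseteq M^\lambda$. If $\lambda\in\Gamma$ is not a partition, $S^\lambda:=0$. Homomorphisms. For $\lambda,\mu\in\Gamma$ let $\mathcal{D}_{\lambda,\mu}=\mathcal{D}_\lambda\cap\mathcal{D}_\mu^{-1}$, a set of representatives of $W_\lambda\backslash W/W_\mu$. $\mathrm{Hom}_{\mathcal{H}}(M^\mu,M^\lambda)$ has $R$-basis $\varphi_d^{\lambda,\mu}$ ($d\in\mathcal{D}_{\lambda,\mu}$), where $\varphi_d^{\lambda,\mu}(x_\mu)=\sum_{w\in W_\lambda dW_\mu}T_w$. Let $\mathcal{D}^\wedge_{\lambda,\mu}$ be the set of $d\in\mathcal{D}_{\lambda,\mu}$ with $P^\lambda_i d\subseteq\bigcup_{j\ge i}P^\mu_j$ for all $i\ge1$ (equivalently, the corresponding row-semistandard generalized tableau of shape $\lambda$ and content $\mu$ has only entries $\ge i$ in its $i$-th row, for every $i$).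 Put $\mathrm{Hom}^\wedge_{\mathcal{H}}(M^\mu,M^\lambda)=\bigoplus_{d\in\mathcal{D}^\wedge_{\lambda,\mu}}R\varphi_d^{\lambda,\mu}$. Composites of such homomorphisms again lie in the corresponding module $\mathrm{Hom}^\wedge_{\mathcal{H}}$. Chain complex. For $n\ge0$ let $\Delta_n^\lambda$ be the set of chains $\gamma=(\lambda^{(0)}\triangleleft\cdots\triangleleft\lambda^{(n)})$ in $\Gamma$ with $\lambda^{(0)}=\lambda$, let $M_\gamma=\mathrm{Hom}^\wedge_{\mathcal{H}}(M^{\lambda^{(0)}},M^{\lambda^{(1)}})\otimes\cdots\otimes\mathrm{Hom}^\wedge_{\mathcal{H}}(M^{\lambda^{(n-1)}},M^{\lambda^{(n)}})\otimes\mathrm{Hom}_R(M^{\lambda^{(n)}},R)$, and $C_n^\lambda=\bigoplus_{\gamma\in\Delta_n^\lambda}M_\gamma$. $C_n^\lambda$ is a left $\mathcal{H}$-module via the action $(h\varepsilon)(m)=\varepsilon(mh)$ on the last tensor factor. For $n\ge1$, $d_n^\lambda=\sum_{i=1}^n(-1)^{i-1}d_{n,i}^\lambda\colon C_n^\lambda\to C_{n-1}^\lambda$, where $d_{n,i}^\lambda$ maps $M_\gamma$ to $M_{\gamma_i}$ ($\gamma_i$ is $\gamma$ with $\lambda^{(i)}$ omitted) by $\varphi_1\otimes\cdots\otimes\varphi_n\otimes\varepsilon\mapsto\varphi_1\otimes\cdots\otimes(\varphi_{i+1}\circ\varphi_i)\otimes\cdots\otimes\varphi_n\otimes\varepsilon$,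 with $\varphi_{n+1}$ read as $\varepsilon$ when $i=n$ (so $d_1^\lambda(\varphi\otimes\varepsilon)=\varepsilon\circ\varphi$). Finally $C_{-1}^\lambda=\mathrm{Hom}_R(S^\lambda,R)$ and $d_0^\lambda\colon C_0^\lambda=\mathrm{Hom}_R(M^\lambda,R)\to C_{-1}^\lambda$ is restriction $\varepsilon\mapsto\varepsilon|_{S^\lambda}$. $\widetilde{C}_*^\lambda$ is the resulting chain complex $0\to C^\lambda_{a(\lambda)}\to\cdots\to C_1^\lambda\to C_0^\lambda\to C_{-1}^\lambda\to0$, where $a(\lambda)$ is the largest $n$ with $\Delta_n^\lambda\neq\emptyset$. *)

(* Defs.v *)
From HB Require Import structures.
From mathcomp Require Import all_boot all_order all_fingroup all_algebra.
From mathcomp Require Import boolp classical_sets functions cardinality fsbigop.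
From mathcomp Require Import generic_quotient.

Set Implicit Arguments.
Unset Strict Implicit.
Unset Printing Implicit Defensive.

Import GRing.Theory.
Local Open Scope ring_scope.
Local Open Scope quotient_scope.

Section Span.
Variables (R : pzRingType) (V : lmodType R).

Definition Rspan (A : set V) : set V := [set v | exists (n : nat)
  (a : 'I_n -> R) (x : 'I_n -> V), (forall i, A (x i)) /\
  v = \sum_i a i *: x i].

Lemma Rspan_submod (A : set V) : subsemimod_closed (fun v => `[< Rspan A v >]).
Proof.
split=> [|a v /asboolP[n [c [x [Ax ->]]]]]; last first.
  apply/asboolP; exists n, (fun i => a * c i), x; split=> //.
  by rewrite scaler_sumr; apply: eq_bigr => i _; rewrite scalerA.
split=> [|u v /asboolP[n [c [x [Ax ->]]]] /asboolP[m [d [y [Ay ->]]]]].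
  apply/asboolP; exists 0%N, (fun=> 0), (fun=> 0).
  by split=> [[]//|]; rewrite big_ord0.
apply/asboolP; exists (n + m)%N.
exists (fun i => match fintype.split i with inl j => c j | inr j => d j end).
exists (fun i => match fintype.split i with inl j => x j | inr j => y j end).
split=> [i|]; first by case: (fintype.split i).
rewrite big_split_ord /=; congr (_ + _); apply: eq_bigr => i _.
  by rewrite (unsplitK (inl i : 'I_n + 'I_m)).
by rewrite (unsplitK (inr i : 'I_n + 'I_m)).
Qed.

End Span.

Section HomR.
Variables (R : comNzRingType) (U V : lmodType R).

Definition linear_pred (f : U -> V) : bool := `[< linear f >].

Lemma linear_pred_submod : subsemimod_closed linear_pred.
Proof.
split=> [|a f /asboolP lf]; last first.
  apply/asboolP => b u v; change (a *: f (b *: u + v) = b *: (a *: f u) + a *: f v).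
  by rewrite lf scalerDr !scalerA mulrC.
split=> [|f g /asboolP lf /asboolP lg]; apply/asboolP => a u v.
  by change (0 = a *: (0 : V) + 0); rewrite scaler0 addr0.
change (f (a *: u + v) + g (a *: u + v) = a *: (f u + g u) + (f v + g v)).
by rewrite lf lg scalerDr addrACA.
Qed.
HB.instance Definition _ :=
  GRing.isSubmodClosed.Build R (U -> V) linear_pred linear_pred_submod.

Record HomR := MkHomR { HomR_fun :> U -> V; _ : linear_pred HomR_fun }.
HB.instance Definition _ := [isSub for HomR_fun].
HB.instance Definition _ := [Choice of HomR by <:].
HB.instance Definition _ := [SubChoice_isSubLmodule of HomR by <:].

Lemma HomR_linear (f : HomR) : linear f.
Proof. by case: f => f /= /asboolP. Qed.
HB.instance Definition _ (f : HomR) :=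
  GRing.isLinear.Build R U V *:%R (HomR_fun f) (HomR_linear f).

Lemma HomR_ext (f g : HomR) : f =1 g -> f = g.
Proof. by move=> fg; apply/val_inj/funext. Qed.

Lemma HomR_addE (f g : HomR) u : (f + g) u = f u + g u. Proof. by []. Qed.
Lemma HomR_scaleE a (f : HomR) u : (a *: f) u = a *: f u. Proof. by []. Qed.

End HomR.

Section HomRComp.
Variables (R : comNzRingType) (U V W : lmodType R).

Lemma comp_linear_pred (g : HomR V W) (f : HomR U V) : linear_pred (g \o f).
Proof. by apply/asboolP => a u v /=; rewrite !linearP. Qed.
Definition HomR_comp (g : HomR V W) (f : HomR U V) : HomR U W :=
  MkHomR (comp_linear_pred g f).

End HomRComp.

(* Formal sums of pairs modulo the congruence of having the same value under
   every bilinear map; [tensor_lift] and [tensor_ind] give the universal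
   property of the tensor product. *)
Section Tensor.
Variables (R : comNzRingType) (U V : lmodType R).

Definition tensor_eval (W : lmodType R) (f : U -> V -> W) (s : seq (U * V)) :=
  \sum_(p <- s) f p.1 p.2.

Definition tensor_rel (s t : seq (U * V)) : bool :=
  `[< forall (W : lmodType R) (f : U -> V -> W),
      bilinear_for *:%R *:%R f -> tensor_eval f s = tensor_eval f t >].

Lemma tensor_rel_equiv : equiv_class_of tensor_rel.
Proof.
split=> [s|s t|t s u].
- exact/asboolP.
- by apply/asboolP/asboolP => h W f bf; rewrite h.
- by move=> /asboolP h1 /asboolP h2; apply/asboolP => W f bf; rewrite h1 ?h2.
Qed.
Canonical tensor_equiv := EquivRelPack tensor_rel_equiv.

Definition tensor := {eq_quot tensor_equiv}.
HB.instance Definition _ := Choice.on tensor.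

Definition tensor_lift (W : lmodType R) (f : U -> V -> W) (x : tensor) : W :=
  tensor_eval f (repr x).

Lemma tensor_lift_pi (W : lmodType R) (f : U -> V -> W) s :
  bilinear_for *:%R *:%R f -> tensor_lift f (\pi_tensor s) = tensor_eval f s.
Proof.
move=> bf; rewrite /tensor_lift.
by have /eqmodP/asboolP -> // : repr (\pi_tensor s) = s %[mod tensor];
  rewrite ?reprK.
Qed.

Lemma tensor_ext (x y : tensor) :
  (forall (W : lmodType R) (f : U -> V -> W), bilinear_for *:%R *:%R f ->
     tensor_lift f x = tensor_lift f y) -> x = y.
Proof. by move=> h; rewrite -[x]reprK -[y]reprK; apply/eqmodP/asboolP. Qed.

Definition tensor_zero : tensor := \pi_tensor [::].
Definition tensor_add (x y : tensor) : tensor := \pi_tensor (repr x ++ repr y).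
Definition tensor_scale (a : R) (x : tensor) : tensor :=
  \pi_tensor [seq (a *: p.1, p.2) | p <- repr x].

Section Lift.
Variables (W : lmodType R) (f : U -> V -> W).
Hypothesis bf : bilinear_for *:%R *:%R f.

Lemma tensor_lift0 : tensor_lift f tensor_zero = 0.
Proof. by rewrite tensor_lift_pi // /tensor_eval big_nil. Qed.

Lemma tensor_liftD x y :
  tensor_lift f (tensor_add x y) = tensor_lift f x + tensor_lift f y.
Proof. by rewrite tensor_lift_pi // /tensor_eval big_cat. Qed.

Lemma bilinear_scalel a u v : f (a *: u) v = a *: f u v.
Proof.
have f0 : f 0 v = 0.
  by apply: (@addIr _ (f 0 v)); rewrite add0r -[X in X + _]scale1r -bf.1
            scale1r addr0.
by have := bf.1 v a u 0; rewrite /= addr0 f0 addr0.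
Qed.

Lemma tensor_liftZ a x :
  tensor_lift f (tensor_scale a x) = a *: tensor_lift f x.
Proof.
rewrite tensor_lift_pi // /tensor_eval big_map scaler_sumr.
by apply: eq_bigr => p _; apply: bilinear_scalel.
Qed.

End Lift.

Definition tensor_opp (x : tensor) := tensor_scale (-1) x.

Lemma tensor_addA : associative tensor_add.
Proof.
by move=> x y z; apply: tensor_ext => W f bf; rewrite !tensor_liftD ?addrA.
Qed.
Lemma tensor_addC : commutative tensor_add.
Proof.
by move=> x y; apply: tensor_ext => W f bf; rewrite !tensor_liftD // addrC.
Qed.
Lemma tensor_add0 : left_id tensor_zero tensor_add.
Proof.
move=> x; apply: tensor_ext => W f bf.
by rewrite tensor_liftD // tensor_lift0 // add0r.
Qed.
Lemma tensor_addN : left_inverse tensor_zero tensor_opp tensor_add.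
Proof.
move=> x; apply: tensor_ext => W f bf.
by rewrite tensor_liftD // tensor_liftZ // tensor_lift0 // scaleN1r addNr.
Qed.
HB.instance Definition _ := GRing.isZmodule.Build tensor
  tensor_addA tensor_addC tensor_add0 tensor_addN.

Lemma tensor_scaleA a b (x : tensor) :
  tensor_scale a (tensor_scale b x) = tensor_scale (a * b) x.
Proof. by apply: tensor_ext => W f bf; rewrite !tensor_liftZ // scalerA. Qed.
Lemma tensor_scale1 : left_id 1 tensor_scale.
Proof. by move=> x; apply: tensor_ext => W f bf; rewrite tensor_liftZ ?scale1r. Qed.
Lemma tensor_scaleDr : right_distributive tensor_scale +%R.
Proof.
move=> a x y; apply: tensor_ext => W f bf.
by rewrite tensor_liftZ // !tensor_liftD // !tensor_liftZ // scalerDr.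
Qed.
Lemma tensor_scaleDl (x : tensor) :
  {morph tensor_scale^~ x : a b / a + b >-> a + b}.
Proof.
move=> a b; apply: tensor_ext => W f bf.
by rewrite tensor_liftD // !tensor_liftZ // scalerDl.
Qed.
HB.instance Definition _ := GRing.Zmodule_isLmodule.Build R tensor
  tensor_scaleA tensor_scale1 tensor_scaleDr tensor_scaleDl.

Definition tensor_pure (u : U) (v : V) : tensor := \pi_tensor ([:: (u, v)]).

Lemma tensor_lift_pure (W : lmodType R) (f : U -> V -> W) u v :
  bilinear_for *:%R *:%R f -> tensor_lift f (tensor_pure u v) = f u v.
Proof. by move=> bf; rewrite tensor_lift_pi // /tensor_eval big_seq1. Qed.

Lemma tensor_lift_linear (W : lmodType R) (f : U -> V -> W) :
  bilinear_for *:%R *:%R f -> linear (tensor_lift f).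
Proof.
by move=> bf a x y; rewrite [LHS]tensor_liftD //; congr (_ + _);
  apply: tensor_liftZ.
Qed.

Lemma tensor_pure_bilinear : bilinear_for *:%R *:%R tensor_pure.
Proof.
split=> [v a u u'|u a v v']; apply: tensor_ext => W f bf /=;
  rewrite (tensor_liftD bf) (tensor_liftZ bf) !tensor_lift_pure //.
  exact: bf.1.
exact: bf.2.
Qed.

Lemma tensor_ind (x : tensor) :
  exists s : seq (U * V), x = \sum_(p <- s) tensor_pure p.1 p.2.
Proof.
exists (repr x); apply: tensor_ext => W f bf; rewrite {1}/tensor_lift.
elim: (repr x) => [|p s ih]; first by rewrite /tensor_eval !big_nil tensor_lift0.
by rewrite /tensor_eval !big_cons tensor_liftD // tensor_lift_pure // -ih.
Qed.

End Tensor.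

Section DirectSum.
Variables (R : pzRingType) (I : choiceType) (M : I -> lmodType R).

Definition dprod := forall i, M i.
HB.instance Definition _ := Choice.on dprod.

Let dadd (f g : dprod) : dprod := fun i => f i + g i.
Let dopp (f : dprod) : dprod := fun i => - f i.
Let dzero : dprod := fun i => 0.
Let dscale (a : R) (f : dprod) : dprod := fun i => a *: f i.

Fact daddA : associative dadd.
Proof. by move=> f g h; apply: functional_extensionality_dep => i; apply: addrA. Qed.
Fact daddC : commutative dadd.
Proof. by move=> f g; apply: functional_extensionality_dep => i; apply: addrC. Qed.
Fact dadd0 : left_id dzero dadd.
Proof. by move=> f; apply: functional_extensionality_dep => i; apply: add0r. Qed.
Fact daddN : left_inverse dzero dopp dadd.
Proof. by move=> f; apply: functional_extensionality_dep => i; apply: addNr. Qed.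
HB.instance Definition _ := GRing.isZmodule.Build dprod daddA daddC dadd0 daddN.

Fact dscaleA a b f : dscale a (dscale b f) = dscale (a * b) f.
Proof. by apply: functional_extensionality_dep => i; apply: scalerA. Qed.
Fact dscale1 : left_id 1 dscale.
Proof. by move=> f; apply: functional_extensionality_dep => i; apply: scale1r. Qed.
Fact dscaleDr : right_distributive dscale +%R.
Proof. by move=> a f g; apply: functional_extensionality_dep => i; apply: scalerDr. Qed.
Fact dscaleDl f : {morph dscale^~ f : a b / a + b >-> a + b}.
Proof. by move=> a b; apply: functional_extensionality_dep => i; apply: scalerDl. Qed.
HB.instance Definition _ := GRing.Zmodule_isLmodule.Build R dprod
  dscaleA dscale1 dscaleDr dscaleDl.

Definition dsum_pred (f : dprod) : bool :=
  `[< finite_set [set i | f i != 0] >].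

Lemma dsum_pred_submod : subsemimod_closed dsum_pred.
Proof.
split=> [|a f /asboolP ff]; last first.
  apply/asboolP; apply: sub_finite_set ff => i /=; apply: contraNN.
  by move=> /eqP fi; apply/eqP; change (a *: f i = 0); rewrite fi scaler0.
split=> [|f g /asboolP ff /asboolP fg]; apply/asboolP.
  by apply: (sub_finite_set _ (finite_set0 I)) => i /=; rewrite eqxx.
apply: (@sub_finite_set _ _ ([set i | f i != 0] `|` [set i | g i != 0])%classic).
  move=> i /= fgi; case: (eqVneq (f i) 0) => [fi|]; [right|by left].
  by move: fgi; change (f i + g i != 0 -> g i != 0); rewrite fi add0r.
by rewrite finite_setU.
Qed.
HB.instance Definition _ :=
  GRing.isSubmodClosed.Build R dprod dsum_pred dsum_pred_submod.

Record dsum := MkDsum { dsum_fun :> dprod; _ : dsum_pred dsum_fun }.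
HB.instance Definition _ := [isSub for dsum_fun].
HB.instance Definition _ := [Choice of dsum by <:].
HB.instance Definition _ := [SubChoice_isSubLmodule of dsum by <:].

End DirectSum.

(* W is 'S_r acting on 'I_r = {0, .., r-1}; the product of permutations in the
   library is already the one of the right action, i(vw) = (iv)w. *)
Section SymmetricGroup.
Variable r : nat.

Definition simple_refl : {set 'S_r} :=
  [set tperm p.1 p.2 | p : 'I_r * 'I_r & p.1.+1 == p.2 :> nat].

Lemma tperm_gen_simple (i j : 'I_r) : (i < j)%N -> tperm i j \in <<simple_refl>>%g.
Proof.
have [n] := ubnP (j - i); elim: n i j => // n ih i j /ltnSE le_n lt_ij.
have [eq_j|ne_j] := eqVneq (i.+1) j.
  by apply/mem_gen/imsetP; exists (i, j) => //; rewrite inE; apply/eqP.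
have lt_ij' : (i.+1 < j)%N by rewrite ltn_neqAle ne_j.
pose k := Ordinal (ltn_trans lt_ij' (ltn_ord j)).
have ki : tperm i k \in <<simple_refl>>%g.
  by apply/mem_gen/imsetP; exists (i, k); rewrite ?inE /=.
have kj : tperm k j \in <<simple_refl>>%g.
  apply: ih => //; rewrite /= subnS; apply: leq_trans le_n.
  by rewrite prednK // subn_gt0.
have -> : tperm i j = (tperm k j ^ tperm i k)%g.
  by rewrite tpermJ tpermR tpermD // -val_eqE /= ltn_eqF.
by rewrite groupJ.
Qed.

Lemma simple_refl_gen : <<simple_refl>>%g = [set: 'S_r].
Proof.
apply/setP => w; rewrite inE; have [ts -> _] := prod_tpermP w.
apply: group_prod => [[i j]] _ /=.
case: (ltngtP i j) => [lt_ij|lt_ij|/val_inj ->]; first exact: tperm_gen_simple.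
  by rewrite tpermC tperm_gen_simple.
by rewrite tperm1 group1.
Qed.

Definition is_word_of_length (w : 'S_r) (n : nat) : bool :=
  [exists c : {ffun 'I_n -> 'S_r},
    [forall i, c i \in simple_refl] && (w == \prod_i c i)%g].

Lemma ex_word w : exists n, is_word_of_length w n.
Proof.
have: w \in <<simple_refl>>%g by rewrite simple_refl_gen inE.
move=> /gen_prodgP[n [c Sc ->]]; exists n; apply/existsP; exists (finfun c).
apply/andP; split; first by apply/forallP => i; rewrite ffunE.
by apply/eqP/eq_bigr => i _; rewrite ffunE.
Qed.

Definition len (w : 'S_r) : nat := ex_minn (ex_word w).

End SymmetricGroup.

(* The R-algebra with basis T_w and the Iwahori-Hecke multiplication: these
   data determine it up to a unique isomorphism matching the T_w. *)
Record hecke (R : idomainType) (q : R) (r : nat) := Hecke {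
  hecke_alg :> algType R;
  T : 'S_r -> hecke_alg;
  T_basis : bijective (fun a : {ffun 'S_r -> R} => \sum_w a w *: T w);
  T_id : T 1%g = 1;
  T_mul_up : forall w s : 'S_r, s \in simple_refl r ->
    len (w * s)%g = (len w).+1 -> T w * T s = T (w * s)%g;
  T_mul_down : forall w s : 'S_r, s \in simple_refl r ->
    len w = (len (w * s)%g).+1 ->
    T w * T s = q *: T (w * s)%g + (q - 1) *: T w }.

(* A composition of r is a finitely supported sequence of natural numbers of
   sum r; it is represented by the list of its terms without trailing zeros,
   so that the i-th term (counted from 0) is [nth 0 la i] for every i. *)
Section Compositions.
Variable r : nat.

Record composition := Composition {
  parts :> seq nat;
  compositionP : (last 1 parts != 0)%N && (sumn parts == r) }.
HB.instance Definition _ := [isSub for parts].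
HB.instance Definition _ := [Countable of composition by <:].

Implicit Types la mu : composition.

Definition part la (i : nat) : nat := nth 0%N la i.

Definition psum la (e : nat) : nat := (\sum_(i < e) part la i)%N.

Definition is_partition la : bool := sorted geq la.

Definition dominated la mu : Prop := forall e, (psum la e <= psum mu e)%N.

Definition sdominated la mu : Prop := dominated la mu /\ la <> mu.

(* The conjugate; only meaningful when la is a partition. *)
Definition conj_seq (s : seq nat) : seq nat :=
  mkseq (fun j => count (fun x => (j < x)%N) s) (\max_(x <- s) x)%N.

Lemma max_seq_mem (s : seq nat) :
  (0 < \max_(x <- s) x)%N -> (\max_(x <- s) x)%N \in s.
Proof.
elim: s => [|x s ih]; rewrite ?big_nil // big_cons inE.
case: (leqP (\max_(y <- s) y)%N x) => [|lt_x _]; first by rewrite eqxx.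
by rewrite ih ?orbT // (leq_ltn_trans _ lt_x).
Qed.

Lemma conj_seqP la :
  (last 1 (conj_seq la) != 0)%N && (sumn (conj_seq la) == r).
Proof.
case: la => s /= /andP[_ /eqP <-]; rewrite /conj_seq; apply/andP; split.
  case: (posnP (\max_(x <- s) x)%N) => [-> //|m_gt0].
  rewrite (last_nth 0%N) size_mkseq.
  case: (\max_(x <- s) x)%N m_gt0 (max_seq_mem m_gt0) => // m _ ms.
  rewrite /= -[X in nth _ X]/(mkseq _ m.+1) nth_mkseq // -lt0n -has_count.
  by apply/hasP; exists m.+1.
rewrite !sumnE big_map -{1}[X in iota 0 X]subn0 -/(index_iota 0 _) big_mkord.
rewrite (eq_bigr (fun j : 'I__ => \sum_(x <- s) (j < x)%N))%N; last first.
  by move=> j _; rewrite -big_mkcond sum1_count.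
rewrite exchange_big /=; apply/eqP/eq_big_seq => x xs.
have le_x : (x <= \max_(y <- s) y)%N by rewrite (big_rem x) //= leq_maxl.
by rewrite -big_mkcond /= (big_ord_narrow le_x) sum1_card card_ord.
Qed.

Definition conj la : composition := Composition (conj_seqP la).

Lemma psum_le la e : (psum la e <= r)%N.
Proof.
case/andP: (compositionP la) => _ /eqP eq_r.
suff: (psum la e <= sumn la)%N by rewrite eq_r.
rewrite /psum /part; elim: (parts la) e => [|x s ih] [|e]; rewrite ?big_ord0 //.
  by rewrite big1 // => i _; rewrite nth_nil.
by rewrite big_ord_recl leq_add2l ih.
Qed.

Definition block la (i : nat) : {set 'I_r} :=
  [set k : 'I_r | (psum la i <= k < psum la i.+1)%N].

(* [block la i] is empty for i >= size la. *)
Definition young la : {set 'S_r} :=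
  [set w : 'S_r | [forall i : 'I_(size la), w @: block la i == block la i]].

Definition mincoset la : {set 'S_r} :=
  [set d | [forall w in (young la :* d)%g, (len d <= len w)%N]].

Definition mindcoset la mu : {set 'S_r} := mincoset la :&: (mincoset mu)^-1%g.

Definition upper_mindcoset la mu : {set 'S_r} :=
  [set d in mindcoset la mu | [forall i : 'I_(size la),
    d @: block la i \subset \bigcup_(j < size mu | (i <= j)%N) block mu j]].

Definition box la := {i : 'I_(size la) & 'I_(part la i)}.
Definition brow la (b : box la) : nat := tag b.
Definition bcol la (b : box la) : nat := tagged b.

Definition filling la := {ffun box la -> 'I_r}.

Lemma canon_tab_subproof la (b : box la) : (psum la (brow b) + bcol b < r)%N.
Proof.
apply: leq_trans (psum_le la (brow b).+1).
by rewrite /psum big_ord_recr /= ltn_add2l ltn_ord.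
Qed.
Definition canon_tab la : filling la :=
  [ffun b => Ordinal (canon_tab_subproof b)].

Definition tab_act la (t : filling la) (w : 'S_r) : filling la :=
  [ffun b => w (t b)].

Definition is_tableau la (t : filling la) : bool :=
  injectiveb t && [forall k, k \in codom t].

Definition row_standard la (t : filling la) : bool :=
  is_tableau t && [forall b, forall b',
    (brow b == brow b') && (bcol b < bcol b')%N ==> (t b < t b')%N].

Definition standard la (t : filling la) : bool :=
  [&& is_partition la, row_standard t & [forall b, forall b',
    (bcol b == bcol b') && (brow b < brow b')%N ==> (t b < t b')%N]].

Definition is_transpose la mu (t : filling la) (t' : filling mu) : bool :=
  [forall b, forall b',
    (brow b == bcol b') && (bcol b == brow b') ==> (t b == t' b')].

(* The unique w such that t^la w has transpose t^(conj la); the default is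
   never used when la is a partition. *)
Definition wconj la : 'S_r :=
  odflt 1%g [pick w : 'S_r |
    is_transpose (tab_act (canon_tab la) w) (canon_tab (conj la))].

End Compositions.

Section RightIdeal.
Variables (R : idomainType) (q : R) (r : nat) (H : hecke q r) (x : H).

Definition rideal_pred (m : H) : bool := `[< exists h : H, m = x * h >].

Lemma rideal_pred_submod : subsemimod_closed rideal_pred.
Proof.
split=> [|a m /asboolP[h ->]].
  split=> [|m n /asboolP[h ->] /asboolP[k ->]]; apply/asboolP.
    by exists 0; rewrite mulr0.
  by exists (h + k); rewrite mulrDr.
by apply/asboolP; exists (a *: h); rewrite scalerAr.
Qed.
HB.instance Definition _ :=
  GRing.isSubmodClosed.Build R H rideal_pred rideal_pred_submod.

Record rideal := MkRideal { rideal_val :> H; _ : rideal_pred rideal_val }.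
HB.instance Definition _ := [isSub for rideal_val].
HB.instance Definition _ := [Choice of rideal by <:].
HB.instance Definition _ := [SubChoice_isSubLmodule of rideal by <:].

Lemma rideal_gen_subproof (h : H) : rideal_pred (x * h).
Proof. by apply/asboolP; exists h. Qed.
Definition rideal_gen (h : H) : rideal := MkRideal (rideal_gen_subproof h).

Lemma rideal_act_subproof (m : rideal) (h : H) : rideal_pred (rideal_val m * h).
Proof. by case: m => m /= /asboolP[k ->]; apply/asboolP; exists (k * h); rewrite mulrA. Qed.
Definition rideal_act (m : rideal) (h : H) : rideal :=
  MkRideal (rideal_act_subproof m h).

End RightIdeal.

Section Complex.
Variables (R : idomainType) (q : R) (r : nat) (H : hecke q r).
Implicit Types la mu : composition r.

Definition xla la : H := \sum_(w in young la) T H w.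
Definition yla la : H := \sum_(w in young la) (- q) ^- len w *: T H w.
Definition zla la : H := xla la * T H (wconj la) * yla (conj la).

Definition Mperm la : lmodType R := rideal (xla la).

(* [eps] and [phi] are the unique maps with the stated values; the default 0
   of [xget] is never used for d in the relevant set of representatives. *)
Definition eps la (d : 'S_r) : HomR (Mperm la) R^o :=
  xget 0 [set e : HomR (Mperm la) R^o | forall f, f \in mincoset la ->
    e (rideal_gen (xla la) (T H f)) = (d == f)%:R].

Definition specht_pred la (m : Mperm la) : bool :=
  if is_partition la then `[< exists h : H, (m : rideal _) = zla la * h :> H >]
  else m == 0.

Lemma specht_pred_submod la : subsemimod_closed (@specht_pred la).
Proof.
rewrite /specht_pred; case: (is_partition la); last first.
  split=> [|a m /eqP->]; last by rewrite /in_mem /= scaler0.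
  by split=> [|m n /eqP-> /eqP->]; rewrite /in_mem /= ?addr0 eqxx.
split=> [|a m /asboolP[h hm]].
  split=> [|m n /asboolP[h hm] /asboolP[k kn]]; apply/asboolP.
    by exists 0; rewrite mulr0.
  by exists (h + k); rewrite mulrDr -hm -kn.
by apply/asboolP; exists (a *: h); rewrite -scalerAr -hm.
Qed.
HB.instance Definition _ la :=
  GRing.isSubmodClosed.Build R (Mperm la) (@specht_pred la)
    (@specht_pred_submod la).

Record specht_type la :=
  MkSpecht { specht_val :> Mperm la; _ : specht_pred specht_val }.
HB.instance Definition _ la := [isSub for @specht_val la].
HB.instance Definition _ la := [Choice of specht_type la by <:].
HB.instance Definition _ la := [SubChoice_isSubLmodule of specht_type la by <:].

Definition Specht la : lmodType R := specht_type la.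

(* Hom_H(M^mu, M^la), with the source first. *)
Definition hlinear_pred mu la (f : HomR (Mperm mu) (Mperm la)) : bool :=
  `[< forall (m : Mperm mu) (h : H), f (rideal_act m h) = rideal_act (f m) h >].

Lemma hlinear_pred_submod mu la : subsemimod_closed (@hlinear_pred mu la).
Proof.
split=> [|a f /asboolP hf].
  split=> [|f g /asboolP hf /asboolP hg]; apply/asboolP => m h.
    by apply/val_inj; rewrite /= mul0r.
  by rewrite !HomR_addE hf hg; apply/val_inj; rewrite /= mulrDl.
apply/asboolP => m h.
by rewrite !HomR_scaleE hf; apply/val_inj; rewrite /= scalerAl.
Qed.
HB.instance Definition _ mu la :=
  GRing.isSubmodClosed.Build R (HomR (Mperm mu) (Mperm la)) (@hlinear_pred mu la)
    (@hlinear_pred_submod mu la).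

Record HomH mu la := MkHomH {
  HomH_val :> HomR (Mperm mu) (Mperm la); _ : hlinear_pred HomH_val }.
HB.instance Definition _ mu la := [isSub for @HomH_val mu la].
HB.instance Definition _ mu la := [Choice of HomH mu la by <:].
HB.instance Definition _ mu la := [SubChoice_isSubLmodule of HomH mu la by <:].

(* phi_d^{la, mu} goes from M^mu to M^la: in [phi] and [upper_mindcoset] the
   target comes first. *)
Definition phi la mu (d : 'S_r) : HomH mu la :=
  xget 0 [set f : HomH mu la |
    (f (rideal_gen (xla mu) 1) : rideal _) =
      \sum_(w in (young la :* d * young mu)%g) T H w :> H].

Definition upper_pred mu la (f : HomH mu la) : bool :=
  `[< Rspan [set phi la mu d | d in [set` upper_mindcoset la mu]]%classic f >].

HB.instance Definition _ mu la :=
  GRing.isSubmodClosed.Build R (HomH mu la) (@upper_pred mu la)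
    (Rspan_submod _).

Record HomU mu la := MkHomU {
  HomU_val :> HomH mu la; _ : upper_pred HomU_val }.
HB.instance Definition _ mu la := [isSub for @HomU_val mu la].
HB.instance Definition _ mu la := [Choice of HomU mu la by <:].
HB.instance Definition _ mu la := [SubChoice_isSubLmodule of HomU mu la by <:].

(* A chain (la <| mu) of length 1 is given by mu. *)
Record chain1 la := MkChain1 {
  chain1_top :> composition r; _ : `[< sdominated la chain1_top >] }.
HB.instance Definition _ la := [isSub for @chain1_top la].
HB.instance Definition _ la := [Choice of chain1 la by <:].

Definition Mchain1 la (g : chain1 la) : lmodType R :=
  tensor (HomU la g) (HomR (Mperm g) R^o).

(* The part C_1 -> C_0 -> C_{-1} of the complex, on which exactness in degree 0
   depends. *)
Definition C1 la : lmodType R := dsum (@Mchain1 la).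
Definition C0 la : lmodType R := HomR (Mperm la) R^o.
Definition Cm1 la : lmodType R := HomR (Specht la) R^o.

Definition d1_chain la (g : chain1 la) : Mchain1 g -> C0 la :=
  tensor_lift (fun (f : HomU la g) (e : HomR (Mperm g) R^o) =>
    HomR_comp e f : C0 la).

Lemma d1_chain_bilinear la (g : chain1 la) :
  bilinear_for *:%R *:%R (fun (f : HomU la g) (e : HomR (Mperm g) R^o) =>
    HomR_comp e f : C0 la).
Proof.
split=> [e a f f'|f a e e']; apply: HomR_ext => m //.
exact: (HomR_linear e a (f m) (f' m)).
Qed.

Definition d1 la (c : C1 la) : C0 la :=
  \sum_(g \in [set: chain1 la]) d1_chain (dsum_fun c g).

Lemma d1_chain_linear la (g : chain1 la) : linear (@d1_chain la g).
Proof. exact: tensor_lift_linear (d1_chain_bilinear g). Qed.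
HB.instance Definition _ la (g : chain1 la) :=
  GRing.isLinear.Build R (Mchain1 g) (C0 la) *:%R (@d1_chain la g)
    (@d1_chain_linear la g).

Lemma d1E la (c : C1 la) (s : seq (chain1 la)) : uniq s ->
  (forall g, g \notin s -> dsum_fun c g = 0) ->
  d1 c = \sum_(g <- s) d1_chain (dsum_fun c g).
Proof.
move=> us cs; rewrite /d1 (fsbigE s) //; last first.
  by move=> g _ /cs ->; rewrite linear0.
by apply: eq_bigl => g; rewrite in_setT.
Qed.

Lemma d1_linear la : linear (@d1 la).
Proof.
move=> a c c'.
have [s us sP] : exists2 s : seq (chain1 la), uniq s & forall g, g \notin s ->
    dsum_fun c g = 0 /\ dsum_fun c' g = 0.
  have fin (b : C1 la) : exists s : seq (chain1 la),
      [set g | dsum_fun b g != 0]%classic = [set` s]%classic.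
    by case: b => b /= /asboolP /finite_seqP.
  have [[s sE] [s' sE']] := (fin c, fin c').
  exists (undup (s ++ s')); first exact: undup_uniq.
  move=> g; rewrite mem_undup mem_cat negb_or => /andP[gs gs'].
  split; apply/eqP; apply: contraT => cg.
    by have : [set` s]%classic g by [rewrite -sE]; rewrite /= (negbTE gs).
  by have : [set` s']%classic g by [rewrite -sE']; rewrite /= (negbTE gs').
rewrite !(d1E us) => [|g /sP[]//|g /sP[]//|g /sP[cg c'g]]; last first.
  by change (a *: dsum_fun c g + dsum_fun c' g = 0); rewrite cg c'g scaler0 addr0.
rewrite scaler_sumr -big_split; apply: eq_bigr => g _.
exact: (d1_chain_linear a (dsum_fun c g) (dsum_fun c' g)).
Qed.
HB.instance Definition _ la :=
  GRing.isLinear.Build R (C1 la) (C0 la) *:%R (@d1 la) (@d1_linear la).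

Lemma specht_val_linear_pred la : linear_pred (@specht_val la).
Proof. by apply/asboolP => a u v. Qed.

Definition d0 la (e : C0 la) : Cm1 la :=
  HomR_comp e (MkHomR (specht_val_linear_pred la)).

Lemma d0_linear la : linear (@d0 la).
Proof. by move=> a e e'; apply: HomR_ext. Qed.
HB.instance Definition _ la :=
  GRing.isLinear.Build R (C0 la) (Cm1 la) *:%R (@d0 la) (@d0_linear la).

Definition K0 la : set (C0 la) :=
  Rspan [set e | exists (t : filling la) (d : 'S_r),
    [/\ standard t, d \in mincoset la, t = tab_act (canon_tab la) d
      & e = eps la d]].

End Complex.

Arguments d1 {R q r} H la c.
Arguments d0 {R q r} H la e.
Arguments K0 {R q r} H la _.

(* Main.v *)
Require Import Defs.
From HB Require Import structures.
From mathcomp Require Import all_boot all_fingroup all_algebra.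
From mathcomp Require Import zify.
From mathcomp Require Import boolp.
From mathcomp Require classical_sets cardinality.

(** The three assertions follow from three facts: the composite [d_0 d_1] is zero,
    the functionals [eps_t] with [t] standard are independent on the Specht module, and
    every [eps_t] is a combination of standard ones modulo the image of [d_1]. Indeed,
    write an element of the kernel of [d_0] as [a + b] with [a] in the image of [d_1]
    and [b] in [K_0]; then [b] lies in the kernel too, so it is zero.

    Lengths are counted as inversions, so that minimal coset representatives are the
    permutations increasing on blocks and row-standard tableaux are words recording
    the row of each entry. Coefficients in the Hecke algebra are computed with the
    trace form, for which [T_w] and [T_(w^-1)] are dual up to a power of [q].

    [d_0 d_1 = 0] ([d1_d0]). A homomorphism from [M^la] to [M^mu] maps [z_la] into
    [x_mu H y_(la')]. If [mu] strictly dominates [la], every permutation sends two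
    entries of some row of [mu] to one column of [la] ([dominance_collision]), and then
    [x_mu T_w y_(la') = 0] ([xla_T_yla0]).

    Independence ([K0_ker]). If [t^la d] is standard, [d] is a prefix of [w_la], say
    [w_la = d g] with lengths adding up ([standard_prefix]). All terms [T_w] of [z_la]
    other than [T_(w_la)] are longer, so that among the [f] of length at most [l(d)]
    only [f = d] contributes to [z_la T_(g^-1)] ([zla_trace]). This is a triangular
    system with units on the diagonal.

    Straightening ([eps_straighten]). Move [k] boxes of [la] from row [i + 1] up to row
    [i] to obtain [mu], and let [X] be the row [i] of a row-standard [mu]-tableau. The
    composite of its functional with [phi_1] is the sum of [q^inv(Y, X \ Y) eps_Y] over
    the subsets [Y] of [X] that can be row [i] of a [la]-tableau
    ([subset_sum_range]). If [t] is not standard, there are a row [i] with entries [U]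
    and an initial part [Z] of row [i + 1] such that fewer than [#|Z|] elements of [U]
    are smaller than [max Z]. A signed sum of the relations for the sets
    [X = (U + Z) \ S], where [S] runs over the subsets of [Z] and has weight the
    product of the [- q^e(z)] for [z] in [S], factors for each [Y] as a product over
    the elements outside [Y]. With the right exponents [e(z)] a factor vanishes unless
    [Y] has fewer elements beyond [max Z] than [U] ([garnir_coef0]). The term [S = Z]
    is a unit times [eps_t], the other terms lie in the image of [d_1], and the
    surviving [Y] are larger for a suitable order ([measure]). *)

Set Implicit Arguments.
Unset Strict Implicit.
Unset Printing Implicit Defensive.

Import GRing.Theory.

(** * Inversions and the length function *)

Section Inversions.
Variable r : nat.
Implicit Types (u v w : 'S_r) (i j k : 'I_r).

Definition ninv w : nat :=
  (\sum_(i < r) \sum_(j < r) ((i < j) && (w j < w i)))%N.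

Lemma perm_neq_lt w i j : i != j -> (w i < w j) = ~~ (w j < w i).
Proof. by rewrite -(inj_eq (@perm_inj _ w)) -val_eqE /=; lia. Qed.

(** An inversion of [u * v] is an inversion of [u] that [v] leaves alone, or a
    pair that only [v] inverts; the hypothesis says that [v] undoes no
    inversion of [u], so that the two counts add up. *)
Lemma ninvM u v :
  (forall i j, i < j -> u j < u i -> v (u j) < v (u i)) ->
  ninv (u * v) = (ninv u + ninv v)%N.
Proof.
move=> uv; rewrite {3}/ninv (reindex_inj (@perm_inj _ u)) /=.
under [X in (_ + X)%N]eq_bigr => i _ do rewrite (reindex_inj (@perm_inj _ u)) /=.
have swap : (\sum_(i < r) \sum_(j < r) ((u i < u j) && (v (u j) < v (u i))) =
    \sum_(i < r) \sum_(j < r) [&& i < j, u i < u j & v (u j) < v (u i)])%N.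
  apply: eq_bigr => i _; apply: eq_bigr => j _; congr nat_of_bool.
  case: (ltngtP i j) => [//|lt_ji|/val_inj->]; last by rewrite ltnn.
  apply/negbTE/negP => /andP[lt_u lt_v].
  by have := uv _ _ lt_ji lt_u; lia.
rewrite swap -big_split; apply: eq_bigr => i _; rewrite -big_split.
apply: eq_bigr => j _ /=; rewrite !permM.
case: ltnP => //= lt_ij; have ne_ij : i != j by rewrite -val_eqE /=; lia.
have /= := uv _ _ lt_ij; have := perm_neq_lt u ne_ij; case: (u j < u i) => /= ->.
  by move/(_ isT) => ->.
by move=> _.
Qed.

Lemma ninvV w : ninv w^-1 = ninv w.
Proof.
rewrite /ninv exchange_big (reindex_inj (@perm_inj _ w)) /=.
apply: eq_bigr => i _; rewrite (reindex_inj (@perm_inj _ w)) /=.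
by apply: eq_bigr => j _; rewrite !permK andbC.
Qed.

Section Adjacent.
Variables (a b : 'I_r) (ab : a.+1 = b :> nat).

Lemma adj_neq : a != b.
Proof. by rewrite -val_eqE /=; lia. Qed.

Lemma adj_ltN w : ~~ (w a < w b) = (w b < w a).
Proof. by rewrite -perm_neq_lt // eq_sym adj_neq. Qed.

Lemma tperm_adj_lt i j : i < j -> (i != a) || (j != b) ->
  tperm a b i < tperm a b j.
Proof.
rewrite -!val_eqE /=; move=> lt_ij ne.
by case: (tpermP a b i); case: (tpermP a b j);
  do ?[move=> ->]; do ?[move/eqP; rewrite -val_eqE /= => ?]; lia.
Qed.

Lemma ninv_adj : ninv (tperm a b) = 1%N.
Proof.
rewrite /ninv (bigD1 a) //= (bigD1 b) //= tpermL tpermR -ab ltnSn /=.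
rewrite !big1 // => [i ia|j ja].
  apply: big1 => j _; case: ltnP => //= lt_ij; apply/eqP; rewrite eqb0 -leqNgt.
  by apply: ltnW; rewrite tperm_adj_lt ?ia.
case: ltnP => //= lt_aj; have := tperm_adj_lt lt_aj.
by rewrite ja orbT tpermL ab => /(_ isT) /ltnW; rewrite leqNgt => /negbTE->.
Qed.

Lemma ninv_mulR_up w : (w^-1 a < w^-1 b)%g ->
  ninv (w * tperm a b) = (ninv w).+1.
Proof.
move=> lt_ab; rewrite ninvM ?ninv_adj ?addn1 // => i j lt_ij lt_w.
apply: tperm_adj_lt => //; rewrite -negb_and; apply/negP => /andP[/eqP wj /eqP wi].
by move: lt_ab; rewrite -wi -wj !permK; lia.
Qed.

Lemma ninv_mulR_down w : (w^-1 b < w^-1 a)%g ->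
  ninv w = (ninv (w * tperm a b)).+1.
Proof.
move=> lt_ba; rewrite -ninv_mulR_up; first by rewrite -mulgA tperm2 mulg1.
by rewrite invMg tpermV !permM tpermL tpermR.
Qed.

Lemma ninv_mulL_up w : w a < w b -> ninv (tperm a b * w) = (ninv w).+1.
Proof.
by move=> ab_w; rewrite -ninvV invMg tpermV ninv_mulR_up ?invgK // ninvV.
Qed.

Lemma ninv_mulL_down w : w b < w a -> ninv w = (ninv (tperm a b * w)).+1.
Proof.
move=> ab_w; rewrite -ninvV (@ninv_mulR_down w^-1) ?invgK //.
by rewrite -[in RHS]ninvV invMg tpermV.
Qed.

Lemma adj_simple : tperm a b \in simple_refl r.
Proof. by apply/imsetP; exists (a, b); rewrite // inE /= ab. Qed.

End Adjacent.

Lemma simpleP (s : 'S_r) : s \in simple_refl r ->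
  exists a b : 'I_r, a.+1 = b :> nat /\ s = tperm a b.
Proof.
by case/imsetP => -[a b]; rewrite inE /= => /eqP ab ->; exists a, b.
Qed.

Lemma inc_interval (f : 'I_r -> nat) i j : i < j ->
  (forall a b : 'I_r, a.+1 = b :> nat -> i <= a -> b <= j -> f a < f b) -> f i < f j.
Proof.
have [n] := ubnP (j - i); elim: n i j => // n ih i j le_n lt_ij f_inc.
have [eq_j|ne_j] := eqVneq i.+1 j; first exact: f_inc.
have lt_ij' : i.+1 < j by lia.
pose k := Ordinal (ltn_trans lt_ij' (ltn_ord j)).
apply: (@ltn_trans (f k)); first by apply: f_inc => //=; lia.
apply: ih => /=; [by lia|by []|] => a b ab ia bj; apply: f_inc => //; lia.
Qed.

Lemma inc_perm1 w : (forall i j, i < j -> w i < w j) -> w = 1%g.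
Proof.
have ge u : (forall i j, i < j -> u i < u j) -> forall i, i <= u i.
  move=> inc [n n_lt] /=; elim: n n_lt => // n ih n_lt.
  by have := inc (Ordinal (ltnW n_lt)) (Ordinal n_lt) (ltnSn n);
    have := ih (ltnW n_lt); lia.
move=> w_inc; have wV_inc i j : i < j -> (w^-1 i < w^-1 j)%g.
  move=> lt_ij; rewrite perm_neq_lt; last by rewrite -val_eqE /=; lia.
  by apply/negP => /w_inc; rewrite !permKV; lia.
apply/permP => i; rewrite perm1; apply/val_inj/eqP; rewrite eqn_leq ge // andbT.
by have := ge _ wV_inc (w i); rewrite permK.
Qed.

Lemma has_descent w : w != 1%g ->
  exists a b : 'I_r, a.+1 = b :> nat /\ (w^-1 b < w^-1 a)%g.
Proof.
case: (boolP [exists a : 'I_r, exists b : 'I_r,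
    (a.+1 == b :> nat) && (w^-1 b < w^-1 a)%g]).
  by move=> /existsP[a /existsP[b /andP[/eqP ab ?]]]; exists a, b.
move=> no /eqP[]; rewrite -[w]invgK (_ : w^-1 = 1)%g ?invg1 //.
apply: inc_perm1 => i j lt_ij.
apply: (@inc_interval (fun k => (w^-1 k)%g)) => // a b ab _ _.
rewrite perm_neq_lt ?adj_neq //; apply: contra no => lt_w.
by apply/existsP; exists a; apply/existsP; exists b; rewrite ab eqxx.
Qed.

Lemma ninv1 : ninv (1%g : 'S_r) = 0%N.
Proof.
by rewrite /ninv big1 // => i _; rewrite big1 // => j _; rewrite !perm1; lia.
Qed.

Lemma ninv_eq0 w : (ninv w == 0%N) = (w == 1%g).
Proof.
apply/eqP/eqP => [|->]; last exact: ninv1.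
by move=> w0; apply/eqP; apply: contraT => /has_descent[a [b [ab /ninv_mulR_down]]];
  rewrite w0 => /(_ ab).
Qed.

Lemma ninv_mulR_simple w s : s \in simple_refl r -> ninv (w * s) <= (ninv w).+1.
Proof.
move=> /simpleP[a [b [ab ->]]].
case: (boolP (w^-1 a < w^-1 b)%g) => [/ninv_mulR_up ->//|].
by rewrite adj_ltN // => /ninv_mulR_down->//; lia.
Qed.

Lemma lenE w : len w = ninv w.
Proof.
rewrite /len; case: ex_minnP => n /existsP[c /andP[/forallP Sc /eqP wE]] min_n.
apply/eqP; rewrite eqn_leq; apply/andP; split.
  apply: min_n; have [m] := ubnP (ninv w); elim: m {wE c Sc} w => // m ih w le_m.
  have [->|/has_descent[a [b [ab lt_w]]]] := eqVneq w 1%g.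
    rewrite ninv1; apply/existsP; exists (finfun (fun i : 'I_0 => 1%g)).
    by rewrite big_ord0 eqxx andbT; apply/forallP => -[].
  have := ninv_mulR_down ab lt_w; set w' := (w * _)%g => wE.
  have /existsP[c /andP[/forallP Sc /eqP w'E]] : is_word_of_length w' (ninv w').
    by apply: ih; lia.
  rewrite wE; apply/existsP.
  exists (finfun (fun i : 'I_(ninv w').+1 =>
    if unlift ord_max i is Some j then c j else tperm a b)).
  apply/andP; split.
    apply/forallP => i; rewrite ffunE; case: unliftP => [j _|_]; first exact: Sc.
    exact: adj_simple.
  rewrite big_ord_recr /= ffunE unlift_none.
  rewrite (eq_bigr (fun x => c x)) => [|x _]; last first.
    by rewrite ffunE (_ : widen_ord _ x = lift ord_max x) ?liftK //;
      apply/val_inj; rewrite [RHS]lift_max.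
  by rewrite -w'E /w' -mulgA tperm2 mulg1.
rewrite {}wE {min_n}; elim: n c Sc => [|n ih] c Sc; first by rewrite big_ord0 ninv1.
rewrite big_ord_recr /=; apply: leq_trans (ninv_mulR_simple _ (Sc _)) _.
rewrite ltnS; pose c' := finfun (fun x => c (widen_ord (leqnSn n) x)).
rewrite (eq_bigr (fun x => c' x)) => [|x _]; last by rewrite ffunE.
by apply: ih => x; rewrite ffunE.
Qed.

Lemma descent_fact w : w != 1%g -> exists (a b : 'I_r) (w' : 'S_r),
  [/\ a.+1 = b :> nat, w = (w' * tperm a b)%g, ninv w = (ninv w').+1
    & (w'^-1 a < w'^-1 b)%g].
Proof.
move=> /has_descent[a [b [ab lt_w]]]; exists a, b, (w * tperm a b)%g.
split=> //; first by rewrite -mulgA tperm2 mulg1.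
  exact: ninv_mulR_down.
by rewrite invMg tpermV !permM tpermL tpermR.
Qed.

Lemma descent_factL w : w != 1%g -> exists (a b : 'I_r) (w' : 'S_r),
  [/\ a.+1 = b :> nat, w = (tperm a b * w')%g, ninv w = (ninv w').+1
    & w' a < w' b].
Proof.
rewrite -invg_eq1 => /descent_fact[a [b [w' [ab wE]]]].
by rewrite ninvV -(ninvV w') => wL lt_w'; exists a, b, w'^-1%g; split;
  rewrite // -[w]invgK wE invMg tpermV.
Qed.

Lemma ninvM_le u v : ninv (u * v) <= ninv u + ninv v.
Proof.
have [n] := ubnP (ninv v); elim: n v => // n ih v.
have [->|/descent_fact[a [b [v' [ab -> -> _]]]] le_n] := eqVneq v 1%g.
  by rewrite mulg1 leq_addr.
rewrite mulgA addnS; apply: leq_trans (ninv_mulR_simple _ (adj_simple ab)) _.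
exact: ih.
Qed.

End Inversions.

(** * Blocks of a composition and row words *)

Section Blocks.
Variable r : nat.
Implicit Types (la mu : composition r) (u v w d : 'S_r) (c e : nat).

Lemma psum0 la : psum la 0 = 0%N.
Proof. by rewrite /psum big_ord0. Qed.

Lemma psumS la e : psum la e.+1 = (psum la e + part la e)%N.
Proof. by rewrite /psum big_ord_recr. Qed.

Lemma psum_mono la e e' : e <= e' -> psum la e <= psum la e'.
Proof.
move=> /subnK<-; elim: (e' - e)%N => // n ih.
by rewrite addSn psumS (leq_trans ih) ?leq_addr.
Qed.

Lemma part_size la c : size la <= c -> part la c = 0%N.
Proof. exact: nth_default. Qed.

Lemma psum_size la e : size la <= e -> psum la e = r.
Proof.
move=> /subnK<-; elim: (e - _)%N => [|n ih].
  rewrite add0n; have /andP[_ /eqP sum_la] := compositionP la.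
  by rewrite -[RHS]sum_la sumnE (big_nth 0%N) big_mkord.
by rewrite addSn psumS ih part_size ?addn0 ?leq_addl.
Qed.

Lemma part_gt0_size la c : 0 < part la c -> c < size la.
Proof. by move=> gt0; rewrite ltnNge; apply/negP => /part_size; lia. Qed.

Lemma eq_psum la mu : psum la =1 psum mu -> la = mu.
Proof.
move=> eq_ps; have eq_part : part la =1 part mu.
  by move=> c; have := eq_ps c.+1; rewrite !psumS eq_ps => /addnI.
have size_le (x y : composition r) : part x =1 part y -> size x <= size y.
  move=> xy; rewrite leqNgt; apply/negP => lt_yx.
  have := xy (size x).-1; rewrite /part nth_last [RHS]nth_default; last by lia.
  have /andP[+ _] := compositionP x.
  by case: (parts x) lt_yx => //= a s _ /negP ne /eqP.
apply/val_inj; apply: (@eq_from_nth _ 0%N); last by move=> i _; apply: eq_part.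
by apply/eqP; rewrite eqn_leq !size_le.
Qed.

Lemma ex_composition (s : seq nat) : sumn s = r ->
  exists la : composition r, forall c, part la c = nth 0%N s c.
Proof.
elim/last_ind: s => [|s x ih] sum_s.
  have s0P : (last 1 [::] != 0)%N && (sumn [::] == r) by rewrite /= -sum_s.
  by exists (Composition s0P) => c.
have [x0|x0] := eqVneq x 0%N.
  have [|la laE] := ih; first by move: sum_s; rewrite sumn_rcons x0 addn0.
  exists la => c; rewrite laE nth_rcons x0.
  by case: ltngtP => // ?; rewrite nth_default //; lia.
have sP : (last 1 (rcons s x) != 0)%N && (sumn (rcons s x) == r).
  by rewrite last_rcons x0 sum_s eqxx.
by exists (Composition sP).
Qed.

Definition blk la (k : 'I_r) : nat :=
  find (fun c => k < psum la c.+1) (iota 0 (size la)).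

Lemma blk_bounds la (k : 'I_r) :
  psum la (blk la k) <= k < psum la (blk la k).+1.
Proof.
rewrite /blk; set p := (fun c => _).
have hasp : has p (iota 0 (size la)).
  have size_gt0 : 0 < size la.
    rewrite lt0n; apply/eqP => la0; have := psum_size (eq_leq la0).
    by rewrite psum0; have := ltn_ord k; lia.
  apply/hasP; exists (size la).-1; first by rewrite mem_iota /=; lia.
  by rewrite /p prednK // psum_size.
have := nth_find 0%N hasp; have := hasp; rewrite has_find size_iota => find_lt.
rewrite nth_iota // add0n /p => -> /=; rewrite andbT.
case E: (find _ _) find_lt => [|c] c_lt; first by rewrite psum0.
have /(before_find 0%N) /= : (c < find p (iota 0 (size la)))%N by rewrite E.
by rewrite nth_iota /p; [rewrite add0n ltnNge => /negbFE | lia].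
Qed.

Lemma blkP la (k : 'I_r) c : (blk la k == c) = (psum la c <= k < psum la c.+1).
Proof.
have /andP[ge lt] := blk_bounds la k; apply/eqP/idP => [<-|/andP[gec ltc]].
  by rewrite ge lt.
have [lt_c|lt_c|//] := ltngtP (blk la k) c.
  by have := psum_mono la lt_c; lia.
by have := psum_mono la lt_c; lia.
Qed.

Lemma blk_size la k : blk la k < size la.
Proof.
by rewrite ltnNge; apply/negP => /psum_size E; have := blk_bounds la k;
  rewrite psumS E; have := ltn_ord k; lia.
Qed.

Lemma mem_block la c k : (k \in block la c) = (blk la k == c).
Proof. by rewrite blkP inE. Qed.

Lemma blk_mono la (k l : 'I_r) : k <= l -> blk la k <= blk la l.
Proof.
move=> le_kl; rewrite leqNgt; apply/negP => /(psum_mono la).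
by have := blk_bounds la k; have := blk_bounds la l; lia.
Qed.

Lemma blk_lt la (k l : 'I_r) : blk la k < blk la l -> k < l.
Proof. by rewrite !ltnNge; apply: contra => /blk_mono. Qed.

Lemma card_interval p m : p + m <= r -> #|[set k : 'I_r | p <= k < p + m]| = m.
Proof.
move=> le_r; have lt_r (j : 'I_m) : p + j < r by have := ltn_ord j; lia.
rewrite -[RHS]card_ord -(@card_imset _ _ (fun j => Ordinal (lt_r j))); last first.
  by move=> j j' [] /addnI/val_inj.
apply/eq_card => k; rewrite inE; apply/andP/imsetP => [[ge lt]|[j _ ->]].
  have j_lt : k - p < m by lia.
  by exists (Ordinal j_lt) => //; apply/val_inj => /=; lia.
by rewrite /= leq_addr ltn_add2l ltn_ord.
Qed.

Lemma card_block la c : #|block la c| = part la c.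
Proof. by rewrite /block psumS card_interval // -psumS psum_le. Qed.

Lemma youngP la w : reflect (forall k, blk la (w k) = blk la k) (w \in young la).
Proof.
rewrite inE; apply: (iffP forallP) => [stab k|wP i].
  have /eqP/setP/(_ (w k)) := stab (Ordinal (blk_size la k)).
  by rewrite /= imset_f ?mem_block // => /esym/eqP.
rewrite eqEcard card_imset ?leqnn ?andbT; last exact: perm_inj.
by apply/subsetP => k /imsetP[l]; rewrite mem_block => li ->; rewrite mem_block wP.
Qed.

Lemma young1 la : 1%g \in young la.
Proof. by apply/youngP => k; rewrite perm1. Qed.

Lemma youngM la u v : u \in young la -> v \in young la -> (u * v)%g \in young la.
Proof.
by move=> /youngP uP /youngP vP; apply/youngP => k; rewrite permM vP uP.
Qed.

Lemma youngV la u : (u^-1%g \in young la) = (u \in young la).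
Proof.
suff V w : w \in young la -> w^-1%g \in young la.
  by apply/idP/idP => /V; rewrite ?invgK.
by move=> /youngP wP; apply/youngP => k; rewrite -wP permKV.
Qed.

Lemma tperm_young la a b : blk la a = blk la b -> tperm a b \in young la.
Proof. by move=> ab; apply/youngP => k; case: tpermP => [->|->|]. Qed.

Definition block_inc la d : Prop :=
  forall i j : 'I_r, i < j -> blk la i = blk la j -> d i < d j.

Lemma block_inc_adj la d :
  (forall a b : 'I_r, a.+1 = b :> nat -> blk la a = blk la b -> d a < d b) ->
  block_inc la d.
Proof.
move=> d_adj i j lt_ij ij; apply: (@inc_interval _ (fun k => d k)) => // a b ab ia bj.
apply: d_adj => //; have := blk_mono la ia; have := blk_mono la bj.
by have /(blk_mono la) : a <= b; lia.
Qed.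

Lemma young_inc_ninv la u d : u \in young la -> block_inc la d ->
  ninv (u * d) = (ninv u + ninv d)%N.
Proof.
move=> /youngP uP dP; apply: ninvM => i j lt_ij lt_u; apply: dP => //.
by rewrite !uP; have := blk_mono la (ltnW lt_ij); have := blk_mono la (ltnW lt_u);
  rewrite !uP; lia.
Qed.

(** Elements of minimal length in their coset are those increasing on the blocks:
    a descent inside a block could be undone by a transposition of the Young
    subgroup. *)
Lemma mincosetP la d : reflect (block_inc la d) (d \in mincoset la).
Proof.
rewrite inE; apply: (iffP forall_inP) => [d_min|d_inc w].
  apply: block_inc_adj => a b ab eq_ab; rewrite perm_neq_lt ?(adj_neq ab) //.
  apply/negP => /(ninv_mulL_down ab) dE.
  have : (tperm a b * d)%g \in (young la :* d)%g.
    by rewrite mem_rcoset mulgK tperm_young.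
  by move/d_min; rewrite !lenE dE ltnn.
rewrite mem_rcoset => /young_inc_ninv-/(_ _ d_inc).
by rewrite mulgKV !lenE => ->; rewrite leq_addl.
Qed.

Lemma mincoset1 la : 1%g \in mincoset la.
Proof. by apply/mincosetP => i j; rewrite !perm1. Qed.

Lemma not_block_inc la d : d \notin mincoset la ->
  exists a b : 'I_r, [/\ a.+1 = b :> nat, blk la a = blk la b & d b < d a].
Proof.
move=> dN; apply: contrapT => no; move/negP: dN; apply; apply/mincosetP.
apply: block_inc_adj => a b ab eq_ab; rewrite perm_neq_lt ?(adj_neq ab) //.
by apply/negP => lt_d; apply: no; exists a, b.
Qed.

(** The factorisation [W = W_la D_la], by sorting [w] on the blocks of [la].
    Sorting an element of another Young subgroup only uses transpositions of that
    subgroup, since adjacent entries from distinct blocks are already in order. *)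
Lemma young_fact la w : exists u d, [/\ u \in young la, d \in mincoset la,
  w = (u * d)%g & forall mu, w \in young mu -> u \in young mu].
Proof.
have [n] := ubnP (ninv w); elim: n w => // n ih w le_n.
have [w_min|/not_block_inc[a [b [ab eq_ab lt_w]]]] := boolP (w \in mincoset la).
  by exists 1%g, w; split=> [|//||mu _]; rewrite ?mul1g ?young1.
have wE := ninv_mulL_down ab lt_w.
have [|u [d [u_la d_la tw_E u_mu]]] := ih (tperm a b * w)%g; first by lia.
exists (tperm a b * u)%g, d; split=> //.
- by rewrite youngM ?tperm_young.
- by rewrite -mulgA -tw_E mulgA tperm2 mul1g.
move=> mu w_mu; have t_mu : tperm a b \in young mu.
  apply: tperm_young; move/youngP: w_mu => w_mu.
  have := blk_mono mu (ltnW lt_w); have /(blk_mono mu) : a <= b by lia.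
  by rewrite !w_mu; lia.
by rewrite youngM // u_mu // youngM.
Qed.

Lemma young_fact_uniq la u u' d d' : u \in young la -> u' \in young la ->
  d \in mincoset la -> d' \in mincoset la -> (u * d = u' * d')%g ->
  u = u' /\ d = d'.
Proof.
move=> uY u'Y /mincosetP dD /mincosetP d'D eq_ud.
have dE : d = (u^-1 * u' * d')%g by rewrite -mulgA -eq_ud mulKg.
have d'E : d' = (u'^-1 * u * d)%g by rewrite -mulgA eq_ud mulKg.
have Y : (u^-1 * u')%g \in young la by rewrite youngM ?youngV.
have Y' : (u'^-1 * u)%g \in young la by rewrite youngM ?youngV.
have /eqP : ninv (u^-1 * u') = 0%N.
  have := young_inc_ninv Y d'D; have := young_inc_ninv Y' dD.
  by rewrite -dE -d'E; lia.
rewrite ninv_eq0 => /eqP uu'; split; last by rewrite dE uu' mul1g.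
by rewrite -[u']mul1g -(mulgV u) -mulgA uu' mulg1.
Qed.

(** [roww la w] lists the row of each entry in the tableau [t^la w]: it is the
    row-standard tableau [t^la d] for the representative [d] of [W_la w]. *)
Definition roww la w : {ffun 'I_r -> nat} := [ffun x => blk la (w^-1%g x)].

Lemma roww_perm la w k : roww la w (w k) = blk la k.
Proof. by rewrite ffunE permK. Qed.

Lemma roww_young la u w : u \in young la -> roww la (u * w) = roww la w.
Proof.
rewrite -youngV => /youngP uP; apply/ffunP => x.
by rewrite !ffunE invMg permM uP.
Qed.

Lemma roww_eqP la w w' : roww la w = roww la w' -> (w' * w^-1)%g \in young la.
Proof.
move=> eq_w; apply/youngP => k.
by rewrite permM -(roww_perm la w' k) -eq_w ffunE.
Qed.

Lemma roww_inj la : {in mincoset la &, injective (roww la)}.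
Proof.
move=> d d' dD d'D /roww_eqP Y.
by have [] := young_fact_uniq Y (young1 la) dD d'D; rewrite ?mul1g ?mulgKV.
Qed.

Lemma card_roww la w c : #|[set x | roww la w x == c]| = part la c.
Proof.
rewrite -card_block -[RHS](card_imset _ (@perm_inj _ w)); apply/eq_card => x.
by rewrite -[x](permKV w) inE roww_perm (mem_imset _ _ (@perm_inj _ w)) mem_block.
Qed.

Lemma ex_roww la (rho : 'I_r -> nat) :
  (forall c, #|[set x | rho x == c]| = part la c) ->
  exists2 d, d \in mincoset la & roww la d =1 rho.
Proof.
move=> rho_la.
have cntE (f : 'I_r -> nat) c :
    count_mem c [tuple f k | k < r] = #|[set k | f k == c]|.
  rewrite /= count_map cardsE cardE -size_filter; congr size.
  by rewrite enumT; apply: eq_filter.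
have /tuple_permP[p /= pE] :
    perm_eq [tuple rho x | x < r] [tuple blk la k | k < r].
  apply/allP => c _; apply/eqP; rewrite !cntE rho_la -card_block.
  by apply/eq_card => k; rewrite mem_block inE.
have [u [d [uY dD pud _]]] := young_fact la p^-1; exists d => // x.
rewrite -(roww_young _ uY) -pud ffunE invgK.
have /(congr1 (fun s => nth 0%N s x)) := pE.
by rewrite !(nth_map x) -?enumT ?size_enum_ord // !nth_ord_enum tnth_mktuple.
Qed.

End Blocks.

(** * Coefficients and the symmetrising trace of the Hecke algebra *)

Section HeckeAlgebra.
Local Open Scope ring_scope.
Variables (R : idomainType) (q : R) (r : nat) (H : hecke q r).
Implicit Types (u v w : 'S_r) (h k x y : H).

Lemma hecke_expand h : exists a : {ffun 'S_r -> R}, h = \sum_w a w *: T H w.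
Proof. by case: (T_basis H) => g _ gK; exists (g h); rewrite gK. Qed.

Definition coef w h : R := projT1 (cid (hecke_expand h)) w.

Lemma coef_expand h : h = \sum_w coef w h *: T H w.
Proof. exact: projT2 (cid (hecke_expand h)). Qed.

Lemma coef_uniq (a : 'S_r -> R) w : coef w (\sum_v a v *: T H v) = a w.
Proof.
set h := \sum_v _; have /bij_inj T_inj := T_basis H.
have /T_inj/ffunP/(_ w) : \sum_v finfun (coef^~ h) v *: T H v
    = \sum_v finfun a v *: T H v.
  under eq_bigr => v _ do rewrite ffunE.
  by under [RHS]eq_bigr => v _ do rewrite ffunE; rewrite -coef_expand.
by rewrite !ffunE.
Qed.

Lemma coef_is_linear w : linear_for *%R (coef w).
Proof.
move=> a h k; rewrite {1}(coef_expand h) {1}(coef_expand k) scaler_sumr -big_split /=.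
under eq_bigr => v _ do rewrite scalerA -scalerDl.
exact: coef_uniq.
Qed.
HB.instance Definition _ w :=
  GRing.isLinear.Build R H R *%R (coef w) (coef_is_linear w).

Lemma coefT w v : coef w (T H v) = (v == w)%:R.
Proof.
rewrite -(coef_uniq (fun u => (v == u)%:R) w); congr coef.
rewrite (bigD1 v) //= eqxx scale1r big1 ?addr0 // => u.
by rewrite eq_sym => /negbTE->; rewrite scale0r.
Qed.

Lemma T_mulR_up (a b : 'I_r) w : a.+1 = b :> nat -> (w^-1%g a < w^-1%g b)%N ->
  T H w * T H (tperm a b) = T H (w * tperm a b)%g.
Proof.
by move=> ab lt_w; rewrite T_mul_up ?adj_simple // !lenE; apply: ninv_mulR_up.
Qed.

Lemma T_mulR_down (a b : 'I_r) w : a.+1 = b :> nat -> (w^-1%g b < w^-1%g a)%N ->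
  T H w * T H (tperm a b) = q *: T H (w * tperm a b)%g + (q - 1) *: T H w.
Proof.
by move=> ab lt_w; rewrite T_mul_down ?adj_simple // !lenE; apply: ninv_mulR_down.
Qed.

Lemma T_sqr (a b : 'I_r) : a.+1 = b :> nat ->
  T H (tperm a b) * T H (tperm a b) = q *: 1 + (q - 1) *: T H (tperm a b).
Proof.
by move=> ab; rewrite T_mulR_down ?tperm2 ?T_id // tpermV tpermL tpermR; lia.
Qed.

Lemma T_mul u v : ninv (u * v) = (ninv u + ninv v)%N ->
  T H u * T H v = T H (u * v)%g.
Proof.
have [n] := ubnP (ninv v); elim: n v => // n ih v.
have [->|/descent_fact[a [b [v' [ab -> -> lt_v']]]] le_n uvE] := eqVneq v 1%g.
  by rewrite mulg1 T_id mulr1.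
have uv'E : ninv (u * v') = (ninv u + ninv v')%N.
  apply/eqP; rewrite eqn_leq ninvM_le -ltnS -addnS -uvE mulgA.
  exact: ninv_mulR_simple (adj_simple ab).
rewrite -T_mulR_up // mulrA ih // T_mul_up ?mulgA ?adj_simple // !lenE.
by rewrite -mulgA uvE uv'E addnS.
Qed.

(** The form [(h, k) |-> coef 1 (h * k)] is the symmetrising trace form: up to
    powers of [q], the bases [T_w] and [T_(w^-1)] are dual to each other. *)
Lemma traceT u v :
  coef 1%g (T H u * T H v) = if v == u^-1%g then q ^+ ninv u else 0.
Proof.
have [n] := ubnP (ninv v); elim: n u v => // n ih u v.
have [-> _|/descent_factL[a [b [v' [ab -> -> lt_v']]]] le_n] := eqVneq v 1%g.
  rewrite T_id mulr1 coefT [_ == u^-1%g]eq_sym invg_eq1.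
  by case: eqP => // ->; rewrite ninv1.
rewrite -[in LHS](@T_mul _ v'); last by rewrite ninv_mulL_up ?(ninv_adj ab).
have -> : (tperm a b * v' == u^-1)%g = (v' == (u * tperm a b)^-1)%g.
  by rewrite invMg tpermV; apply/eqP/eqP => [<-|->]; rewrite mulgA tperm2 mul1g.
rewrite mulrA; case: (boolP (u^-1%g a < u^-1%g b)%N) => [lt_u|].
  rewrite T_mulR_up // ih //; case: eqP => // v'E; exfalso.
  by move: lt_v'; rewrite v'E invMg tpermV !permM tpermL tpermR ltnNge ltnW.
rewrite (adj_ltN ab) => lt_u.
rewrite T_mulR_down // mulrDl -!scalerAl linearP linearZ /= !ih //.
rewrite [v' == u^-1%g]negbTE ?mulr0 ?addr0; last first.
  by apply: contraTneq lt_v' => ->; rewrite -leqNgt ltnW.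
by case: eqP => _; rewrite ?mulr0 // (ninv_mulR_down ab lt_u) exprS.
Qed.

Lemma traceC h k : coef 1%g (h * k) = coef 1%g (k * h).
Proof.
rewrite (coef_expand h) mulr_suml mulr_sumr !linear_sum; apply: eq_bigr => u _.
rewrite -scalerAl -scalerAr !linearZ; congr (_ * _).
rewrite (coef_expand k) mulr_suml mulr_sumr !linear_sum; apply: eq_bigr => v _.
rewrite -scalerAl -scalerAr !linearZ; congr (_ * _) => /=.
rewrite !traceT -(inj_eq invg_inj) invgK eq_sym.
by case: eqP => // ->; rewrite ninvV.
Qed.

Lemma coef_trace w h : coef 1%g (h * T H w^-1%g) = q ^+ ninv w * coef w h.
Proof.
rewrite {1}(coef_expand h) mulr_suml linear_sum (bigD1 w) //= big1 => [|v vw].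
  by rewrite addr0 -scalerAl linearZ /= traceT eqxx mulrC.
by rewrite -scalerAl linearZ /= traceT (inj_eq invg_inj) eq_sym (negbTE vw) mulr0.
Qed.

(** Each factor [T_s] of [T_a] lengthens the elements of a product by at most one,
    so that length [l(a) + l(b)] is reached in [T_a T_b] by [T_(a b)] only. *)
Lemma trace_long z a b : (ninv a + ninv b <= ninv z)%N -> z^-1%g != (a * b)%g ->
  coef 1%g (T H z * T H a * T H b) = 0.
Proof.
have [n] := ubnP (ninv a); elim: n z a => // n ih z a.
have [-> _ _|/descent_factL[c [d [a' [cd -> aE lt_a']]]] le_n le_z zab] := eqVneq a 1%g.
  by rewrite T_id mulr1 mul1g traceT eq_sym => /negbTE->.
rewrite -(@T_mul _ a'); last by rewrite ninv_mulL_up ?(ninv_adj cd).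
rewrite !mulrA; rewrite aE in le_n le_z.
have zab' : ((z * tperm c d)^-1 != a' * b)%g.
  apply: contra zab; rewrite invMg tpermV -mulgA => /eqP <-.
  by rewrite mulgA tperm2 mul1g.
case: (boolP (z^-1%g c < z^-1%g d)%N) => [lt_z|].
  rewrite T_mulR_up // ih ?(ninv_mulR_up cd lt_z) //; lia.
rewrite (adj_ltN cd) => lt_z.
have zE := ninv_mulR_down cd lt_z.
rewrite T_mulR_down // !mulrDl -!scalerAl linearP linearZ /= !ih ?mulr0 ?addr0 //.
- by lia.
- apply/eqP => zE'; have := ninvM_le a' b; rewrite -zE' ninvV; lia.
by lia.
Qed.

Hypothesis q_unit : q \is a GRing.unit.

Lemma coef_TVT u w e : ninv (u * e) = (ninv u + ninv e)%N ->
  coef e (T H u^-1%g * T H w) = if w == (u * e)%g then q ^+ ninv u else 0.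
Proof.
move=> ueE; apply: (mulrI (unitrX (ninv e) q_unit)).
rewrite -coef_trace -mulrA traceC -mulrA T_mul; last first.
  by rewrite -invMg !ninvV addnC.
rewrite -invMg traceT (inj_eq invg_inj) eq_sym; case: eqP => [->|_].
  by rewrite ueE -exprD addnC.
by rewrite mulr0.
Qed.

End HeckeAlgebra.

(** * Permutation modules *)

Section PermutationModules.
Local Open Scope ring_scope.
Variables (R : idomainType) (q : R) (r : nat) (H : hecke q r).
Implicit Types (u v w d e f : 'S_r) (h k : H) (la mu nu : composition r).

Lemma xla_fact la (a b : 'I_r) : a.+1 = b :> nat -> blk la a = blk la b ->
  exists X, xla H la = X * (1 + T H (tperm a b)).
Proof.
move=> ab eq_ab; have tY := tperm_young eq_ab.
exists (\sum_(u in young la | (u^-1%g a < u^-1%g b)%N) T H u).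
rewrite mulrDr mulr1 mulr_suml /xla (bigID (fun u : 'S_r => (u^-1%g a < u^-1%g b)%N)).
congr (_ + _); rewrite (reindex_inj (mulIg (tperm a b))) /=.
apply: eq_big => [u|u /andP[_ lt_u]]; last rewrite T_mulR_up //.
  congr (_ && _).
    by apply/idP/idP => Y; [rewrite -[u](mulgK (tperm a b)) tpermV|]; apply: youngM.
  by rewrite (adj_ltN ab) invMg tpermV !permM tpermL tpermR.
move: lt_u; rewrite (adj_ltN ab) invMg tpermV !permM tpermL tpermR //.
Qed.

Hypothesis q_unit : q \is a GRing.unit.

Lemma yla_fact la (a b : 'I_r) : a.+1 = b :> nat -> blk la a = blk la b ->
  exists Y, yla H la = (1 - q^-1 *: T H (tperm a b)) * Y.
Proof.
move=> ab eq_ab; have tY := tperm_young eq_ab.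
exists (\sum_(v in young la | (v a < v b)%N) (- q) ^- len v *: T H v).
rewrite mulrBl mul1r mulr_sumr /yla (bigID (fun v : 'S_r => (v a < v b)%N)).
congr (_ + _); rewrite (reindex_inj (mulgI (tperm a b))) /= -sumrN.
apply: eq_big => [v|v /andP[_]].
  congr (_ && _).
    by apply/idP/idP => Y; [rewrite -[v](mulKg (tperm a b)) tpermV|]; apply: youngM.
  by rewrite (adj_ltN ab) !permM tpermL tpermR.
rewrite (adj_ltN ab) !permM tpermL tpermR => lt_v; rewrite !lenE.
rewrite ninv_mulL_up // -T_mul ?ninv_mulL_up ?(ninv_adj ab) //.
by rewrite -scalerAl -scalerAr scalerA -scaleNr exprSr invrM ?unitrX ?unitrN ?invrN ?mulNr.
Qed.

Lemma xla_T la (a b : 'I_r) : a.+1 = b :> nat -> blk la a = blk la b ->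
  xla H la * T H (tperm a b) = q *: xla H la.
Proof.
move=> ab /(xla_fact ab)[X ->]; rewrite -mulrA mulrDl mul1r (T_sqr H ab).
rewrite scalerAr; congr (_ * _); rewrite addrCA -[X in _ + (X + _)]scale1r -scalerDl.
by rewrite [1 + _]addrC subrK scalerDr.
Qed.

Lemma T_yla la (a b : 'I_r) : a.+1 = b :> nat -> blk la a = blk la b ->
  T H (tperm a b) * yla H la = - yla H la.
Proof.
move=> ab /(yla_fact ab)[Y ->]; rewrite mulrA -mulNr; congr (_ * _).
rewrite mulrBr mulr1 -scalerAr (T_sqr H ab) scalerDr !scalerA mulVr // scale1r.
by rewrite mulrBr mulVr // mulr1 scalerBl scale1r opprD opprB addrCA subrKC
  opprB addrC.
Qed.

Lemma xla_young la u : u \in young la -> xla H la * T H u = q ^+ ninv u *: xla H la.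
Proof.
have [n] := ubnP (ninv u); elim: n u => // n ih u.
have [->|/descent_factL[a [b [u' [ab -> uE lt_u']]]]] := eqVneq u 1%g.
  by rewrite T_id mulr1 ninv1 scale1r.
rewrite uE => le_n tuY; have eq_ab : blk la a = blk la b.
  move/youngP: tuY => uY; have := blk_mono la (ltnW lt_u').
  have := uY a; have := uY b; rewrite !permM tpermL tpermR => -> ->.
  have /(blk_mono la) : (a <= b)%N by lia.
  by lia.
have u'Y : u' \in young la.
  by rewrite -[u'](mulKg (tperm a b)) youngM ?youngV ?tperm_young.
rewrite -T_mul ?uE ?(ninv_adj ab) // mulrA xla_T // -scalerAl ih //.
by rewrite scalerA exprS.
Qed.

Lemma xla_Tmin la d : d \in mincoset la ->
  xla H la * T H d = \sum_(u in young la) T H (u * d)%g.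
Proof.
move=> /mincosetP dD; rewrite mulr_suml; apply: eq_bigr => u uY.
by rewrite T_mul // (young_inc_ninv uY).
Qed.

Lemma coef_xla_T la d f : d \in mincoset la -> f \in mincoset la ->
  coef d (xla H la * T H f) = (d == f)%:R.
Proof.
move=> dD fD; rewrite xla_Tmin // linear_sum; have [->|df] := eqVneq d f.
  rewrite (bigD1 1%g) ?young1 //= mul1g coefT eqxx big1 ?addr0 // => u /andP[uY u1].
  rewrite coefT -{2}[f]mul1g (can_eq (mulgK f)) (negbTE u1) //.
apply: big1 => u uY; rewrite /= coefT; case: eqP => // ufd.
have [|_ fd] := young_fact_uniq uY (young1 la) fD dD; first by rewrite mul1g.
by rewrite fd eqxx in df.
Qed.

Lemma rideal_expand la h : rideal_pred (xla H la) h ->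
  h = \sum_(f in mincoset la) coef f h *: (xla H la * T H f).
Proof.
suff ex_c : rideal_pred (xla H la) h -> exists c : 'S_r -> R,
    h = \sum_(f in mincoset la) c f *: (xla H la * T H f).
  move=> /ex_c[c hE]; rewrite {1}hE; apply: eq_bigr => d dD; congr (_ *: _).
  rewrite hE linear_sum (bigD1 d) //= linearZ /= coef_xla_T // eqxx mulr1.
  rewrite big1 ?addr0 // => f /andP[fD fd].
  by rewrite linearZ /= coef_xla_T // eq_sym (negbTE fd) mulr0.
case/asboolP => k ->; rewrite (coef_expand k) mulr_sumr.
elim/big_ind: _ => [|x y [c ->] [c' ->]|w _].
- by exists (fun=> 0); rewrite big1 // => f _; rewrite scale0r.
- exists (fun f => c f + c' f); rewrite -big_split /=.
  by apply: eq_bigr => f _; rewrite scalerDl.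
have [u [d [uY dD wE _]]] := young_fact la w.
exists (fun f => if f == d then coef w k * q ^+ ninv u else 0).
rewrite (bigD1 d) //= eqxx big1 ?addr0 => [|f /andP[_ /negbTE->]]; last first.
  by rewrite scale0r.
rewrite -scalerAr {2}wE -T_mul; last by rewrite (young_inc_ninv uY) //; apply/mincosetP.
by rewrite mulrA (xla_young uY) -scalerAl scalerA.
Qed.

Lemma rideal_valP la (m : Mperm H la) : rideal_pred (xla H la) (rideal_val m).
Proof. by case: m. Qed.

Lemma Mperm_expand la (m : Mperm H la) : m =
  \sum_(f in mincoset la) coef f (rideal_val m) *: rideal_gen (xla H la) (T H f).
Proof.
apply/val_inj; rewrite linear_sum /= {1}(rideal_expand (rideal_valP m)).
by [].
Qed.

Lemma linear_coef_val la d :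
  linear_pred (fun m : Mperm H la => coef d (rideal_val m) : R^o).
Proof. by apply/asboolP => a m n;
  exact: (@coef_is_linear _ _ _ H d a (rideal_val m) (rideal_val n)). Qed.

(** The basis dual to the [x_la T_d] consists of restricted coefficients of
    [T_d], because [d] is the only minimal representative in its coset. *)
Lemma epsE la d (m : Mperm H la) : d \in mincoset la ->
  eps H la d m = coef d (rideal_val m).
Proof.
move=> dD; pose e0 := MkHomR (linear_coef_val la d).
have epsP f : f \in mincoset la ->
    eps H la d (rideal_gen (xla H la) (T H f)) = (d == f)%:R.
  rewrite /eps; case: classical_sets.xgetP => [e _ eP|no]; first exact: eP.
  by case: (no e0) => f' f'D; apply: coef_xla_T.
rewrite {1}(Mperm_expand m) linear_sum (bigD1 d) //= linearZ /=.
rewrite epsP // eqxx big1 => [|f /andP[fD fd]].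
  by rewrite addr0; apply: mulr1.
by rewrite linearZ /= epsP // eq_sym (negbTE fd); apply: mulr0.
Qed.

Lemma HomR_eps la (e : C0 H la) : e = \sum_(f in mincoset la)
  (e (rideal_gen (xla H la) (T H f)) : R) *: eps H la f.
Proof.
apply: HomR_ext => m; rewrite {1}(Mperm_expand m) linear_sum.
have sumE (I : finType) (P : pred I) (F : I -> C0 H la) :
    (\sum_(i | P i) F i) m = \sum_(i | P i) F i m.
  by elim/big_rec2: _ => // i x y _ <-; rewrite HomR_addE.
rewrite sumE; apply: eq_bigr => f fD.
by rewrite linearZ HomR_scaleE epsE //; apply: mulrC.
Qed.

End PermutationModules.

(** * Conjugate partitions *)

Section Conjugate.
Variable r : nat.
Implicit Types (la mu nu : composition r) (c e j : nat) (w u v d : 'S_r).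

Lemma partitionP la :
  reflect (forall c, part la c.+1 <= part la c) (is_partition la).
Proof.
apply: (iffP (sortedP 0%N)) => [dec c|dec c _]; last exact: dec.
have [/dec//|ge_c] := ltnP c.+1 (size la).
by rewrite part_size.
Qed.

Lemma partition_mono la c e : is_partition la -> c <= e -> part la e <= part la c.
Proof.
move=> /partitionP dec /subnK<-; elim: (e - c)%N => // n ih.
exact: leq_trans (dec _) ih.
Qed.

Lemma part_conj la j : part (conj la) j = (\sum_(c < size la) (j < part la c))%N.
Proof.
transitivity (count (fun x => j < x) la).
  have [lt_j|ge_j] := ltnP j (\max_(x <- la) x); first by rewrite /part nth_mkseq.
  rewrite part_size ?size_mkseq //; symmetry; apply/eqP.
  rewrite -leqn0 leqNgt -has_count; apply/hasPn => x x_la; rewrite -leqNgt.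
  exact: leq_trans (leq_bigmax_seq _ x_la isT) ge_j.
by rewrite -sum1_count big_mkcond (big_nth 0%N) big_mkord.
Qed.

(** For a partition the column [j] meets an initial segment of rows. *)
Lemma conj_lt la c j : is_partition la -> (c < part (conj la) j) = (j < part la c).
Proof.
move=> la_part; rewrite part_conj; apply/idP/idP => [|lt_j].
  apply: contraLR; rewrite -!leqNgt => le_j.
  rewrite (bigID (fun i : 'I_(size la) => i < c)) /= [X in _ + X]big1 => [|i].
    rewrite addn0; apply: (@leq_trans (\sum_(i < size la | i < c) 1)%N).
      by apply: leq_sum => i _; case: (j < _).
    have [c_le|c_ge] := leqP c (size la).
      by rewrite (big_ord_narrow c_le) sum_nat_const card_ord muln1.
    rewrite (eq_bigl predT) => [|i]; first by rewrite sum_nat_const card_ord muln1 ltnW.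
    by rewrite (ltn_trans (ltn_ord i)).
  rewrite -leqNgt => /(partition_mono la_part) => le_c.
  by rewrite ltnNge (leq_trans le_c).
have c_lt : c < size la by apply: part_gt0_size; lia.
apply: (@leq_trans (\sum_(i < size la | i < c.+1) 1)%N).
  by rewrite (big_ord_narrow c_lt) sum_nat_const card_ord muln1.
rewrite big_mkcond; apply: leq_sum => i _; case: ifP => // lt_ic.
by rewrite (leq_trans lt_j) // partition_mono.
Qed.

Definition tcol la (k : 'I_r) : nat := k - psum la (blk la k).

Lemma blk_col la (k : 'I_r) : (psum la (blk la k) + tcol la k = k :> nat)%N.
Proof. by have := blk_bounds la k; rewrite /tcol; lia. Qed.

Lemma col_lt la k : tcol la k < part la (blk la k).
Proof. by have := blk_bounds la k; rewrite psumS /tcol; lia. Qed.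

Lemma blk_eq la (k : 'I_r) c j : j < part la c -> (psum la c + j = k :> nat)%N ->
  blk la k = c /\ tcol la k = j.
Proof.
move=> lt_j kE; have bk : blk la k = c by apply/eqP; rewrite blkP psumS; lia.
by split=> //; rewrite /tcol bk; lia.
Qed.

Lemma ex_box la c j : j < part la c ->
  exists k : 'I_r, [/\ blk la k = c, tcol la k = j & val k = (psum la c + j)%N].
Proof.
move=> lt_j; have lt_r : psum la c + j < r.
  by have := psum_le la c.+1; rewrite psumS; lia.
by exists (Ordinal lt_r); have [? ?] := @blk_eq la (Ordinal lt_r) c j lt_j erefl.
Qed.

Definition box_of la (k : 'I_r) : box la :=
  existT _ (Ordinal (blk_size la k)) (Ordinal (col_lt la k)).

Lemma canon_box_of la k : canon_tab la (box_of la k) = k.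
Proof. by apply/val_inj; rewrite ffunE /= blk_col. Qed.

Lemma tab_box_of la d k : tab_act (canon_tab la) d (box_of la k) = d k.
Proof. by rewrite ffunE canon_box_of. Qed.

Lemma box_ofE la (b : box la) : brow b = blk la (canon_tab la b) /\
  bcol b = tcol la (canon_tab la b).
Proof.
have [] := @blk_eq la (canon_tab la b) (brow b) (bcol b); rewrite ?ffunE //.
by rewrite /bcol /brow ltn_ord.
Qed.

Section Partition.
Variable la : composition r.
Hypothesis la_part : is_partition la.

(** [w_la] turns the row reading of the diagram into its column reading. *)
Lemma wconjE k :
  (wconj la k = psum (conj la) (tcol la k) + blk la k :> nat)%N.
Proof.
have blk_lt_conj l : blk la l < part (conj la) (tcol la l).
  by rewrite conj_lt ?col_lt.
rewrite /wconj; case: pickP => [w /forallP wP|no] /=.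
  have [k' [bk' ck' k'E]] := ex_box (blk_lt_conj k).
  have /forallP/(_ (box_of (conj la) k')) := wP (box_of la k).
  rewrite tab_box_of canon_box_of /brow /bcol /= bk' ck' !eqxx /= => /eqP ->.
  exact: k'E.
have lt_r l : psum (conj la) (tcol la l) + blk la l < r.
  have [l' [_ _ <-]] := ex_box (blk_lt_conj l); exact: ltn_ord.
pose f l := Ordinal (lt_r l).
have f_inj : injective f.
  move=> l m fE; have [bl cl] := @blk_eq (conj la) (f l) _ _ (blk_lt_conj l) erefl.
  have [bm cm] := @blk_eq (conj la) (f m) _ _ (blk_lt_conj m) erefl.
  apply/val_inj; rewrite /= -(blk_col la l) -(blk_col la m).
  by rewrite -bl -cl -bm -cm fE.
have /negP[] := no (perm f_inj); apply/forallP => b; apply/forallP => b'.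
apply/implyP => /andP[/eqP bb' /eqP cb']; apply/eqP/val_inj.
have [bE cE] := box_ofE b; rewrite ffunE permE /= -bE -cE bb' cb'.
by rewrite ffunE.
Qed.

Lemma blk_wconj k : blk (conj la) (wconj la k) = tcol la k /\
  tcol (conj la) (wconj la k) = blk la k.
Proof.
by apply: blk_eq; rewrite ?wconjE // conj_lt ?col_lt.
Qed.

Lemma wconj_inc : block_inc la (wconj la).
Proof.
move=> k l lt_kl eq_kl; apply: (@blk_lt _ (conj la)).
have [-> _] := blk_wconj k; have [-> _] := blk_wconj l.
by have := blk_col la k; have := blk_col la l; rewrite eq_kl; lia.
Qed.

Lemma ninv_wconj u v : u \in young la -> v \in young (conj la) ->
  ninv (u * wconj la * v) = (ninv u + ninv (wconj la) + ninv v)%N.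
Proof.
move=> uY vY; rewrite -(young_inc_ninv uY wconj_inc) addnC.
rewrite -(ninvV v) -(ninvV (u * wconj la)) -[LHS]ninvV invMg.
apply: (@young_inc_ninv _ (conj la)); first by rewrite youngV.
move=> x y lt_xy eq_xy; rewrite invMg !permM.
set k := ((wconj la)^-1 x)%g; set l := ((wconj la)^-1 y)%g.
have xE : x = wconj la k by rewrite permKV.
have yE : y = wconj la l by rewrite permKV.
have u'Y : (u^-1)%g \in young la by rewrite youngV.
apply: (@blk_lt _ la); move/youngP: u'Y => u'Y; rewrite !u'Y.
move: eq_xy lt_xy; rewrite xE yE !wconjE.
by have [-> _] := blk_wconj k; have [-> _] := blk_wconj l => ->; rewrite ltn_add2l.
Qed.

(** Let two boxes carry an inversion of [d]. As the rows and columns of [t^la d]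
    increase, the box that comes later in the row reading lies strictly to the left,
    so it comes first in the column reading: the pair is an inversion of [w_la].
    Hence [w_la = d g] with [l(w_la) = l(d) + l(g)]. *)
Lemma standard_prefix d : standard (tab_act (canon_tab la) d) ->
  ninv (wconj la) = (ninv d + ninv (d^-1 * wconj la))%N.
Proof.
case/and3P => _ /andP[_ /forallP rowP] /forallP colP.
have row_inc k l : blk la k = blk la l -> tcol la k < tcol la l -> d k < d l.
  move=> bE cE; have /forallP/(_ (box_of la l)) := rowP (box_of la k).
  by rewrite !tab_box_of /brow /bcol /= bE cE eqxx.
have col_inc k l : tcol la k = tcol la l -> blk la k < blk la l -> d k < d l.
  move=> bE cE; have /forallP/(_ (box_of la l)) := colP (box_of la k).
  by rewrite !tab_box_of /brow /bcol /= bE cE eqxx.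
rewrite -ninvM ?mulKVg // => k l lt_kl lt_d; rewrite !permM !permK.
apply: (@blk_lt _ (conj la)); have [-> _] := blk_wconj k; have [-> _] := blk_wconj l.
rewrite ltnNge; apply/negP => le_c; move: lt_d; apply/negP; rewrite -leqNgt.
have := blk_mono la (ltnW lt_kl); rewrite leq_eqVlt => /orP[/eqP eq_b|lt_b].
  apply/ltnW/row_inc => //; have := blk_col la k; have := blk_col la l.
  by rewrite eq_b; lia.
have lt_m : tcol la k < part la (blk la l) by apply: leq_ltn_trans le_c (col_lt _ _).
have [m [bm cm _]] := ex_box lt_m.
have lt_km : d k < d m by apply: col_inc; rewrite ?bm ?cm.
move: le_c; rewrite leq_eqVlt => /orP[/eqP eq_c|lt_c].
  suff -> : l = m by exact: ltnW.
  by apply/val_inj; rewrite /= -(blk_col la l) -(blk_col la m) bm cm eq_c.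
by apply/ltnW/(ltn_trans lt_km)/row_inc; rewrite ?bm ?cm.
Qed.

Lemma sum_lt e (n : nat) : (\sum_(c < e) (c < n) = minn e n)%N.
Proof. by elim: e => [|e ih]; rewrite ?big_ord0 ?min0n // big_ord_recr /= ih; lia. Qed.

Lemma sum_eq e (n : nat) : (\sum_(c < e) (n == c :> nat) = (n < e))%N.
Proof. by elim: e => [|e ih]; rewrite ?big_ord0 // big_ord_recr /= ih; lia. Qed.

(** If no two entries of a row of [mu] went to the same column of [la], then the
    first [e] rows of [mu] would meet each column of [la] in at most [e] boxes,
    whence [mu <= la] in the dominance order. *)
Lemma dominance_collision mu w : dominated la mu -> la <> mu ->
  exists i j : 'I_r, [/\ i != j, blk mu i = blk mu j
    & blk (conj la) (w i) = blk (conj la) (w j)].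
Proof.
move=> la_mu ne; apply: contrapT => no; apply: ne; apply: eq_psum => e.
apply/eqP; rewrite eqn_leq la_mu /=; set nu := conj la in no *.
have inj_mu (i j : 'I_r) : blk mu i = blk mu j -> blk nu (w i) = blk nu (w j) -> i = j.
  by move=> mu_ij nu_ij; apply: contrapT => /eqP ij; apply: no; exists i, j.
have bound j : #|[set k | (blk mu k < e) && (blk nu (w k) == j)]| <=
    \sum_(c < e) (j < part la c).
  set A := [set k | _].
  have le_e : #|A| <= e.
    case: e @A => [|e] A; first
      by rewrite leqn0 cards_eq0 -subset0; apply/subsetP => k; rewrite inE.
    rewrite -[X in _ <= X]card_ord.
    apply: (@leq_card_in _ _ (fun k => inord (blk mu k))).
    move=> k l; rewrite !inE => /andP[lt_k /eqP kj] /andP[lt_l /eqP lj].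
    by move=> /(congr1 (@nat_of_ord _)); rewrite !inordK // => /inj_mu -> //; rewrite kj lj.
  have le_nu : #|A| <= part nu j.
    rewrite -card_block -(card_imset (mem A) (@perm_inj _ w)); apply: subset_leq_card.
    by apply/subsetP => _ /imsetP[k + ->]; rewrite inE mem_block => /andP[].
  under eq_bigr => c _ do rewrite -conj_lt //.
  by rewrite sum_lt leq_min le_e.
have cardE (P : pred 'I_r) : #|[set k | P k]| = (\sum_k P k)%N.
  by rewrite -sum1_card big_mkcond; apply: eq_bigr => k _; rewrite inE; case: (P k).
have -> : psum mu e = (\sum_(k < r) (blk mu k < e))%N.
  rewrite /psum; transitivity (\sum_(c < e) \sum_(k < r) (blk mu k == c :> nat))%N.
    apply: eq_bigr => c _; rewrite -card_block -cardE.
    by apply: eq_card => k; rewrite mem_block inE.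
  by rewrite exchange_big; apply: eq_bigr => k _; rewrite sum_eq.
have -> : (\sum_(k < r) (blk mu k < e) = \sum_(j < size nu)
    #|[set k | (blk mu k < e) && (blk nu (w k) == j)]|)%N.
  under [RHS]eq_bigr => j _ do rewrite cardE.
  rewrite exchange_big; apply: eq_bigr => k _ /=; case: (_ < e) => /=.
    by rewrite sum_eq blk_size.
  by rewrite big1.
apply: (@leq_trans (\sum_(j < size nu) \sum_(c < e) (j < part la c))%N).
  by apply: leq_sum => j _; apply: bound.
rewrite exchange_big; apply: leq_sum => c _ /=.
by rewrite sum_lt geq_minr.
Qed.

End Partition.
End Conjugate.

(** * Homomorphisms to more dominant permutation modules kill the Specht module *)

Section SpechtKernel.
Local Open Scope ring_scope.
Variables (R : idomainType) (q : R) (r : nat) (H : hecke q r).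
Hypothesis q_unit : q \is a GRing.unit.
Implicit Types (u v w d f g : 'S_r) (h k : H) (la mu nu : composition r).

(** Descents of [w] inside a block of [mu] or of [nu] are absorbed by [x_mu] and
    [y_nu]. For a minimal double coset representative the collision gives simple
    reflections [s] of [W_mu] and [s'] of [W_nu] with [s w = w s'], and the factor
    [1 + T_s] of [x_mu] then annihilates the factor [1 - q^-1 T_s'] of [y_nu].
    This works even if [1 + q = 0]. *)
Lemma xla_T_yla0 mu nu w (i j : 'I_r) : i != j -> blk mu i = blk mu j ->
  blk nu (w i) = blk nu (w j) -> xla H mu * T H w * yla H nu = 0.
Proof.
have [n] := ubnP (ninv w); elim: n w i j => // n ih w i j le_n ij mu_ij nu_ij.
have [wD|/not_block_inc[a [b [ab eq_ab lt_w]]]] := boolP (w \in mincoset mu);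
    last first.
  have wE := ninv_mulL_down ab lt_w.
  have -> : w = (tperm a b * (tperm a b * w))%g by rewrite mulgA tperm2 mul1g.
  rewrite -T_mul ?(ninv_adj ab); last by rewrite mulgA tperm2 mul1g wE.
  rewrite mulrA xla_T // -!scalerAl.
  have /youngP tY := tperm_young eq_ab.
  rewrite (ih _ (tperm a b i) (tperm a b j)) ?scaler0 ?(inj_eq perm_inj) //.
  - by rewrite wE in le_n.
  - by rewrite !tY.
  by rewrite !permM !tpermK.
have [wD'|/not_block_inc[a [b [ab eq_ab lt_w]]]] := boolP (w^-1%g \in mincoset nu);
    last first.
  have wE := ninv_mulR_down ab lt_w.
  have -> : w = (w * tperm a b * tperm a b)%g by rewrite -mulgA tperm2 mulg1.
  rewrite -T_mul ?(ninv_adj ab); last by rewrite -mulgA tperm2 mulg1 wE addn1.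
  rewrite mulrA -mulrA T_yla // mulrN.
  have /youngP tY := tperm_young eq_ab.
  rewrite (ih _ i j) ?oppr0 // ?permM ?tY //.
  by rewrite wE in le_n.
wlog lt_ij : i j ij mu_ij nu_ij / (i < j)%N => [hw|].
  case: (ltngtP i j) => [lt_ij|lt_ji|/val_inj eq_ij].
  - exact: (hw i j).
  - by apply: (hw j i) => //; rewrite eq_sym.
  by rewrite eq_ij eqxx in ij.
have {wD} w_inc := mincosetP _ _ wD; have {wD'} wV_inc := mincosetP _ _ wD'.
have lt_b : (i.+1 < r)%N by have := ltn_ord j; lia.
pose b := Ordinal lt_b; have ib : i.+1 = b :> nat by [].
have mu_ib : blk mu i = blk mu b.
  have /(blk_mono mu) : (i <= b)%N by rewrite /=; lia.
  by have /(blk_mono mu) : (b <= j)%N; lia.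
have lt_wib : (w i < w b)%N by apply: w_inc.
have le_wbj : (w b <= w j)%N.
  have [->//|bj] := eqVneq b j; apply/ltnW/w_inc; last by rewrite -mu_ib.
  by move: bj; rewrite -val_eqE /=; lia.
(* [w^-1] is increasing too, so no value can lie between [w i] and [w b] *)
have lt_c : ((w i).+1 < r)%N by have := ltn_ord (w b); lia.
pose c := Ordinal lt_c; have wic : (w i).+1 = c :> nat by [].
have nu_ic : blk nu (w i) = blk nu c.
  have /(blk_mono nu) : (w i <= c)%N by rewrite /=; lia.
  have /(blk_mono nu) : (c <= w j)%N by rewrite /=; lia.
  by rewrite nu_ij; lia.
have wbE : w b = c.
  have := wV_inc (w i) c (ltnSn _) nu_ic; rewrite permK => lt_i.
  have [->//|wbc] := eqVneq (w b) c.
  have lt_cb : (c < w b)%N by move: wbc; rewrite -val_eqE /=; lia.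
  have nu_cb : blk nu c = blk nu (w b).
    have := blk_mono nu (ltnW lt_cb); have := blk_mono nu le_wbj.
    by rewrite -nu_ij nu_ic; lia.
  by have := wV_inc c (w b) lt_cb nu_cb; rewrite permK ltnS leqNgt lt_i.
have [X ->] := xla_fact H ib mu_ib; have [Y ->] := yla_fact H q_unit wic nu_ic.
have swE : (tperm i b * w)%g = (w * tperm (w i) c)%g.
  by rewrite -wbE -tpermJ /conjg !mulgA mulgV mul1g.
have comm : T H (tperm i b) * T H w = T H w * T H (tperm (w i) c).
  rewrite [RHS]T_mulR_up //; last by rewrite -wbE !permK ib.
  by rewrite T_mul ?swE // -swE ninv_mulL_up ?(ninv_adj ib).
have -> : X * (1 + T H (tperm i b)) * T H w = X * T H w * (1 + T H (tperm (w i) c)).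
  by rewrite -!mulrA; congr (_ * _); rewrite mulrDl mul1r comm mulrDr mulr1.
rewrite -mulrA [_ * (_ * Y)]mulrA (_ : (_ + _) * (_ - _) = 0) ?mul0r ?mulr0 //.
rewrite mulrBr mulr1 -scalerAr mulrDl mul1r (T_sqr H wic) addrCA.
rewrite -[X in X + (q - 1) *: _]scale1r -scalerDl [1 + (q - 1)]addrC subrK.
by rewrite -scalerDr scalerA mulVr // scale1r subrr.
Qed.

Lemma xla_mul_yla0 la mu h : is_partition la -> sdominated la mu ->
  xla H mu * h * yla H (conj la) = 0.
Proof.
move=> la_part [dom ne].
transitivity (\sum_w coef w h *: (xla H mu * T H w * yla H (conj la))).
  move: (xla H mu) (yla H (conj la)) => x y.
  rewrite {1}(coef_expand h) mulr_sumr mulr_suml; apply: eq_bigr => w _.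
  by rewrite -scalerAr -scalerAl.
rewrite big1 // => w _.
have [i [j [ij mu_ij nu_ij]]] := dominance_collision la_part w dom ne.
by rewrite (xla_T_yla0 ij mu_ij nu_ij) scaler0.
Qed.

Lemma specht_kernel la mu (f : HomH H la mu) (m : Specht H la) :
  sdominated la mu -> f (specht_val m) = 0.
Proof.
move=> la_mu; case: m => m /=; rewrite /specht_pred.
case: ifP => [la_part /asboolP[h mE]|_ /eqP->]; last by rewrite linear0.
pose k := T H (wconj la) * yla H (conj la) * h.
have -> : m = rideal_act (rideal_gen (xla H la) 1) k.
  by apply/val_inj; rewrite /= mE mulr1 /k /zla !mulrA.
have /asboolP-> : hlinear_pred (HomH_val f) by case: (f).
have /asboolP[c cE] := rideal_valP (f (rideal_gen (xla H la) 1)).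
apply/val_inj => /=; rewrite cE /k.
by rewrite !mulrA -[xla H mu * c * _]mulrA xla_mul_yla0 // mul0r.
Qed.

Lemma d1_d0 la (c : C1 H la) : d0 H la (d1 H la c) = 0.
Proof.
case: (c) => c0 c_fin; have /asboolP/cardinality.finite_seqP[s sE] := c_fin.
rewrite (@d1E _ _ _ _ _ _ (undup s)) ?undup_uniq // => [|g]; last first.
  rewrite mem_undup => gs; apply/eqP; apply: contraT => cg.
  have gE : is_true (c0 g != 0) = is_true (g \in s) :=
    congr1 (fun A : classical_sets.set _ => A g) sE.
  by rewrite /= gE (negbTE gs) in cg.
rewrite linear_sum big1 // => g _ /=.
have [t ->] := tensor_ind (c0 g).
have -> : d1_chain (\sum_(p <- t) tensor_pure p.1 p.2 : Mchain1 H g) =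
    \sum_(p <- t) d1_chain (tensor_pure p.1 p.2 : Mchain1 H g).
  exact: (linear_sum (@d1_chain _ _ _ H la g)).
rewrite linear_sum big1 // => -[f e] _ /=.
apply: HomR_ext => m /=; rewrite /d1_chain tensor_lift_pure /=; last first.
  exact: d1_chain_bilinear.
rewrite specht_kernel ?linear0 //.
by case: g f e {c0 c_fin sE t} => g /= /asboolP.
Qed.

End SpechtKernel.

(** * Standard coordinate functionals are independent on the Specht module *)

Section StandardIndependence.
Local Open Scope ring_scope.
Variables (R : idomainType) (q : R) (r : nat) (H : hecke q r).
Hypothesis q_unit : q \is a GRing.unit.
Implicit Types (u v w d f g a b : 'S_r) (h k : H) (la mu nu : composition r).

(** [z_la] is supported on the elements [u w_la v], whose lengths are at least
    [l(w_la)], with equality only at [w_la]; so if [l(a) + l(b)]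
    is at most [l(w_la)], then [T_a T_b] pairs with [z_la] through [T_(w_la)] alone. *)
Lemma zla_trace la a b : is_partition la -> (ninv a + ninv b <= ninv (wconj la))%N ->
  coef 1%g (zla H la * T H a * T H b) =
    if (wconj la)^-1%g == (a * b)%g then q ^+ ninv (wconj la) else 0.
Proof.
move=> la_part le_w; set w := wconj la in le_w *.
have zE : zla H la = \sum_(u in young la) \sum_(v in young (conj la))
    (- q) ^- len v *: T H (u * w * v)%g.
  rewrite /zla /xla /yla mulr_suml mulr_suml; apply: eq_bigr => u uY.
  rewrite mulr_sumr; apply: eq_bigr => v vY; rewrite -scalerAr.
  have uwE : ninv (u * w) = (ninv u + ninv w)%N.
    by have := ninv_wconj la_part uY (young1 _); rewrite mulg1 ninv1 addn0.
  by rewrite T_mul // T_mul // uwE -ninv_wconj.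
have long u v : u \in young la -> v \in young (conj la) ->
    (u != 1%g) || (v != 1%g) -> coef 1%g (T H (u * w * v)%g * T H a * T H b) = 0.
  move=> uY vY; rewrite -!ninv_eq0 => uv1; have := ninv_wconj la_part uY vY.
  rewrite -/w => uwvE; apply: trace_long; first by lia.
  by apply/eqP => abE; have := ninvM_le a b; rewrite -abE ninvV uwvE; lia.
rewrite zE mulr_suml mulr_suml linear_sum (bigD1 1%g) ?young1 //=.
rewrite [X in _ + X]big1 => [|u /andP[uY u1]]; last first.
  rewrite mulr_suml mulr_suml linear_sum big1 // => v vY.
  by rewrite -!scalerAl linearZ /= long ?u1 // mulr0.
rewrite addr0 mulr_suml mulr_suml linear_sum (bigD1 1%g) ?young1 //=.
rewrite big1 ?addr0 => [|v /andP[vY v1]]; last first.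
  by rewrite -!scalerAl linearZ /= long ?young1 ?v1 ?orbT // mulr0.
rewrite lenE ninv1 expr0 invr1 scale1r mul1g mulg1.
case: eqP => [wE|/eqP ne]; last exact: trace_long.
rewrite -mulrA T_mul; first by rewrite -wE traceT eqxx.
by apply/eqP; rewrite eqn_leq ninvM_le -wE ninvV.
Qed.

Lemma Rspan_ind (V : lmodType R) (A : classical_sets.set V) (P : V -> Prop) :
  P 0 -> (forall c x y, A x -> P y -> P (c *: x + y)) -> forall x, Rspan A x -> P x.
Proof.
move=> P0 PS _ [n [c [x [Ax ->]]]]; elim: n c x Ax => [|n ih] c x Ax.
  by rewrite big_ord0.
rewrite big_ord_recl; apply: PS; first exact: Ax.
exact: (ih (fun i => c (lift ord0 i)) (fun i => x (lift ord0 i))).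
Qed.

Lemma Rspan_0 (V : lmodType R) (A : classical_sets.set V) : Rspan A 0.
Proof. by have [[/asboolP] ] := Rspan_submod A. Qed.

Lemma Rspan_comb (V : lmodType R) (A : classical_sets.set V) (a : R) (x y : V) :
  Rspan A x -> Rspan A y -> Rspan A (a *: x + y).
Proof.
have [[_ addP] scaleP] := Rspan_submod A => xA yA.
by apply/asboolP/addP; [apply: scaleP|]; apply/asboolP.
Qed.

Lemma Rspan_mem (V : lmodType R) (A : classical_sets.set V) (x : V) :
  A x -> Rspan A x.
Proof. by move=> xA; exists 1%N, (fun=> 1), (fun=> x); rewrite big_ord1 scale1r. Qed.

Lemma K0_nonstandard la (e : C0 H la) f : K0 H la e -> f \in mincoset la ->
  ~~ standard (tab_act (canon_tab la) f) -> e (rideal_gen (xla H la) (T H f)) = 0.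
Proof.
move=> eK fD f_nst; move: e eK; apply: Rspan_ind => [//|c x y].
move=> [t [d [d_st dD tE ->]]] y0; rewrite HomR_addE HomR_scaleE y0 epsE //.
rewrite (coef_xla_T _ dD fD); case: eqP => [df|_]; last by rewrite scaler0 addr0.
by rewrite -df -tE d_st in f_nst.
Qed.

(** Suppose that [e] is nonzero on some [x_la T_d], and take [d] of maximal length;
    then [t^la d] is standard and [w_la = d g] with lengths adding up. The coefficient
    of [T_f] in [z_la T_(g^-1)] is, up to a unit, the trace of
    [z_la T_(g^-1) T_(f^-1)], which for [l(f) <= l(d)] is nonzero at [f = d] only. So
    [e] takes a unit multiple of its value at [x_la T_d] on an element of the Specht
    module. *)
Lemma K0_ker la (e : C0 H la) : K0 H la e -> d0 H la e = 0 -> e = 0.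
Proof.
move=> eK e0; pose c f := e (rideal_gen (xla H la) (T H f)) : R.
have specht0 m : specht_pred m -> e m = 0.
  move=> mS; have /(congr1 (fun g : Cm1 H la => g (MkSpecht mS))) := e0.
  by [].
suff c0 f : f \in mincoset la -> c f = 0.
  rewrite (HomR_eps q_unit e) big1 // => f fD; rewrite -/(c f) c0 // scale0r //.
have [n] := ubnP (\max_(w : 'S_r) ninv w - ninv f); elim: n f => // n ih d le_n dD.
have [d_st|d_nst] := boolP (standard (tab_act (canon_tab la) d)); last first.
  exact: K0_nonstandard.
have la_part : is_partition la by case/and3P: d_st.
have wE := standard_prefix la_part d_st; set g := (d^-1 * wconj la)%g in wE.
have zP : rideal_pred (xla H la) (zla H la * T H g^-1%g).
  by apply/asboolP; eexists; rewrite /zla -!mulrA.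
pose m : Mperm H la := MkRideal zP.
have mS : specht_pred m.
  by rewrite /specht_pred la_part; apply/asboolP; exists (T H g^-1%g).
have := specht0 m mS; rewrite {1}(Mperm_expand q_unit m) linear_sum (bigD1 d) //=.
have coef_m f : (ninv f <= ninv d)%N -> coef f (zla H la * T H g^-1%g) =
    if f == d then q ^+ ninv g else 0.
  move=> le_f; apply: (mulrI (unitrX (ninv f) q_unit)).
  rewrite -coef_trace zla_trace ?ninvV ?wE //; last by rewrite addnC leq_add2r.
  rewrite -invMg (inj_eq invg_inj) /g mulgA -{1}[wconj la]mul1g.
  rewrite (can_eq (mulgK _)) eq_sym -eq_mulgV1.
  by case: eqP => [->|_]; rewrite ?mulr0 // -exprD.
rewrite linearZ /= coef_m // eqxx big1 ?addr0 => [|f /andP[fD fd]].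
  move=> qc0; apply: (mulrI (unitrX (ninv g) q_unit)).
  by rewrite mulr0; apply: qc0.
have [le_f|lt_f] := leqP (ninv f) (ninv d).
  by rewrite linearZ /= coef_m // (negbTE fd) scale0r.
rewrite linearZ /= -/(c f) ih ?scaler0 //.
have : (ninv f <= \max_(w : 'S_r) ninv w)%N by apply: leq_bigmax.
by lia.
Qed.

End StandardIndependence.

(** * A quantum Garnir relation *)

Section QGarnir.
Local Open Scope ring_scope.
Variables (R : idomainType) (q : R) (r : nat) (V : lmodType R).
Variable F : {set 'I_r} -> V.
Implicit Types (S U X Y Z : {set 'I_r}) (v x y z : 'I_r).

Definition above Y v : nat := #|[set y in Y | (v < y)%N]|.

(** The exponent of [q] is the number of pairs [v < y] with [y] in [Y] and [v] in
    [X] outside [Y]. *)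
Definition weight Y X : R := \prod_(v in X :\: Y) q ^+ above Y v.

Definition subset_sum (a : nat) X : V :=
  \sum_(Y : {set 'I_r} | (Y \subset X) && (#|Y| == a)) weight Y X *: F Y.

(** In [garnir_coef0] this exponent equals [above Y z] for some [z] of [Z] outside
    [Y]. *)
Definition garnir_exp (a : nat) Z z : nat := (a - #|[set z' in Z | (z' < z)%N]|)%N.

Definition garnir_coef (a : nat) Z v : R :=
  if v \in Z then q ^+ garnir_exp a Z v else 0.

Lemma prod_subset (D Z : {set 'I_r}) (A B : 'I_r -> R) :
  \prod_(v in D) (A v - (if v \in Z then B v else 0)) =
  \sum_(S : {set 'I_r} | S \subset Z :&: D)
    (\prod_(v in S) - B v) * \prod_(v in D :\: S) A v.
Proof.
pose A' v := if v \in D then A v else 1.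
pose B' v := if v \in Z :&: D then - B v else 0.
transitivity (\prod_v (B' v + A' v)).
  rewrite big_mkcond; apply: eq_bigr => v _; rewrite /A' /B' inE.
  by case: (v \in D); case: (v \in Z); rewrite ?add0r ?subr0 // addrC.
rewrite bigA_distr (bigID (fun S : {set 'I_r} => S \subset Z :&: D)) /=.
rewrite [X in _ + X]big1 ?addr0 => [|S /subsetPn[v vS vZD]]; last first.
  by rewrite (bigD1 v) //= vS /B' (negbTE vZD) mul0r.
apply: eq_bigr => S /subsetP SZD; rewrite (bigID (fun v => v \in S)) /=.
congr (_ * _); first by apply: eq_bigr => v vS; rewrite vS /B' SZD.
rewrite big_mkcond [RHS]big_mkcond; apply: eq_bigr => v _; rewrite /A' inE.
by case: (v \in S).
Qed.

Lemma subset_sum_alt (a : nat) X Z : Z \subset X ->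
  \sum_(S : {set 'I_r} | S \subset Z)
    (\prod_(z in S) - q ^+ garnir_exp a Z z) *: subset_sum a (X :\: S) =
  \sum_(Y : {set 'I_r} | (Y \subset X) && (#|Y| == a))
    (\prod_(v in X :\: Y) (q ^+ above Y v - garnir_coef a Z v)) *: F Y.
Proof.
move=> ZX; under eq_bigr => S _ do rewrite /subset_sum scaler_sumr.
rewrite (exchange_big_dep (fun Y : {set 'I_r} => (Y \subset X) && (#|Y| == a))) /=.
  apply: eq_bigr => Y /andP[YX Ya]; rewrite /garnir_coef prod_subset scaler_suml.
  apply: eq_big => [S|S /and3P[SZ YXS _]].
    rewrite Ya andbT subsetI subsetD YX /=; case SZ: (S \subset Z) => //=.
    by rewrite subsetD (subset_trans SZ ZX) disjoint_sym.
  rewrite scalerA /weight; congr (_ * _ *: _); apply: eq_bigl => v.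
  by rewrite !inE; case: (v \in Y); case: (v \in S).
by move=> S Y SZ /andP[YXS ->]; rewrite andbT (subset_trans YXS) ?subsetDl.
Qed.

(** Let [z] be the first element of [Z] with [above Y z >= a - (rank of z in Z)].
    Passing from its predecessor in [Z] to [z], the right-hand side drops by one
    and the left-hand side does not increase; so equality holds at [z], and [z] is
    not in [Y]. The factor of the product at [z] is then zero. *)
Lemma garnir_coef0 (a : nat) X Y Z top : Z \subset X -> Y \subset X -> #|Y| = a ->
  top \in Z -> {in Z, forall z, (z <= top)%N} -> (a < above Y top + #|Z|)%N ->
  \prod_(v in X :\: Y) (q ^+ above Y v - garnir_coef a Z v) = 0.
Proof.
move=> ZX YX Ya topZ top_max lt_a; pose rk z := #|[set z' in Z | (z' < z)%N]|.
pose P z := (z \in Z) && (a <= above Y z + rk z)%N.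
have Ptop : P top.
  rewrite /P topZ /=; suff : (#|Z| <= (rk top).+1)%N by lia.
  rewrite -add1n -(cards1 top); apply: leq_trans (leq_card_setU _ _).
  apply/subset_leq_card/subsetP => z zZ; rewrite !inE zZ /= -val_eqE /=.
  by have := top_max z zZ; rewrite leq_eqVlt.
case: (arg_minnP (fun z : 'I_r => val z) Ptop) => z /andP[zZ ge_a] z_min.
have z_first z' : z' \in Z -> (z' < z)%N -> (above Y z' + rk z' < a)%N.
  move=> z'Z lt_z; rewrite ltnNge; apply/negP => ge'.
  by have := z_min z'; rewrite /P z'Z ge' => /(_ isT); rewrite leqNgt lt_z.
suff [zY zE] : z \notin Y /\ (above Y z + rk z = a)%N.
  rewrite (bigD1 z) ?inE ?zY ?(subsetP ZX) //= /garnir_coef zZ /garnir_exp.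
  by rewrite -/(rk z) -zE addnK subrr mul0r.
have above_le z' : (z' <= z)%N -> (above Y z <= above Y z')%N.
  move=> le_z; apply/subset_leq_card/subsetP => y; rewrite !inE => /andP[-> /=].
  exact: leq_ltn_trans.
have above_lt z' : (z' < z)%N -> z \in Y -> (above Y z < above Y z')%N.
  move=> lt_z zY; apply/proper_card/properP; split.
    apply/subsetP => y; rewrite !inE => /andP[-> /=]; exact: ltn_trans.
  by exists z; rewrite !inE ?zY ?lt_z ?ltnn.
have [rk0|/card_gt0P[z0]] := posnP (rk z).
  rewrite rk0 addn0 in ge_a *; have le_a : (above Y z <= a)%N.
    by rewrite -Ya; apply/subset_leq_card/subsetP => y; rewrite inE => /andP[].
  split; last by lia.
  apply/negP => zY; suff : (above Y z < a)%N by lia.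
  rewrite -Ya; apply/proper_card/properP; split.
    by apply/subsetP => y; rewrite inE => /andP[].
  by exists z; rewrite // inE ltnn andbF.
rewrite inE => Pz0; pose Q z' := (z' \in Z) && (z' < z)%N.
case: (@arg_maxnP _ z0 Q (fun z => val z) Pz0) => z1 /andP[z1Z lt_z1] z1_max.
have rkE : rk z = (rk z1).+1.
  rewrite /rk (_ : [set z' in Z | _] = z1 |: [set z' in Z | (z' < z1)%N]).
    by rewrite cardsU1 inE ltnn andbF.
  apply/setP => z'; rewrite !inE; have [->|ne] := eqVneq z' z1.
    by rewrite z1Z lt_z1.
  have := z1_max z'; rewrite /Q; move: ne; rewrite -val_eqE /=.
  case: (z' \in Z) => //= ne lt_z'; apply/idP/idP => [/lt_z'|]; lia.
have := z_first _ z1Z lt_z1; have := above_le z1 (ltnW lt_z1).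
split; last by lia.
by apply/negP => /(above_lt _ lt_z1); lia.
Qed.

Lemma subset_sum_self U : subset_sum #|U| U = F U.
Proof.
rewrite /subset_sum (big_pred1 U) => [|Y].
  by rewrite /weight setDv big_set0 scale1r.
rewrite /= eqEcard; case YU: (Y \subset U) => //=.
by rewrite eqn_leq (subset_leq_card YU).
Qed.

Hypothesis q_unit : q \is a GRing.unit.

(** In the alternating combination of the [subset_sum] over [X] minus [S], for [S]
    inside [Z], the term [S = Z] is a unit times [F U]. By [garnir_coef0] an [F Y]
    survives only if [#|Z|] plus the number of elements of [Y] beyond [top] is at most
    [#|U|]. *)
Lemma garnir_span (P : V -> Prop) U Z (top : 'I_r) :
    P 0 -> (forall (c : R) (e f : V), P e -> P f -> P (c *: e + f)) ->
    [disjoint U & Z] -> top \in Z -> {in Z, forall z, (z <= top)%N} ->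
    (forall S, S \proper Z -> P (subset_sum #|U| ((U :|: Z) :\: S))) ->
    (forall Y, Y \subset U :|: Z -> #|Y| = #|U| ->
       (above Y top + #|Z| <= #|U|)%N -> P (F Y)) ->
  P (F U).
Proof.
move=> P0 PS UZ topZ top_max P_sum P_Y; set X := U :|: Z in P_sum P_Y.
have P_big (I : finType) (A : pred I) (c : I -> R) (G : I -> V) :
    (forall i, A i -> P (G i)) -> P (\sum_(i | A i) c i *: G i).
  by move=> PG; elim/big_rec: _ => // i e Ai Pe; apply: PS => //; apply: PG.
have ZX : Z \subset X by apply: subsetUr.
have := subset_sum_alt #|U| ZX; rewrite (bigD1 Z) //=.
have -> : X :\: Z = U.
  by rewrite setDUl setDv setU0; apply/setDidPl.
rewrite subset_sum_self; set c := \prod_(z in Z) _; set A := \sum_(S | _) _.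
set B := \sum_(Y | _) _ => eqAB.
have c_unit : c \is a GRing.unit.
  by apply: rpred_prod => z _; rewrite unitrN unitrX.
have PA : P A.
  by apply: P_big => S SZ; apply: P_sum; rewrite properEneq andbC.
have PB : P B.
  rewrite /B (bigID (fun Y => above Y top + #|Z| <= #|U|)%N) /=.
  rewrite [X in _ + X]big1 => [|Y /andP[/andP[YX /eqP Ya]]]; last first.
    rewrite -ltnNge => lt_a.
    by rewrite (@garnir_coef0 #|U| X Y Z top) ?scale0r.
  by rewrite addr0; apply: P_big => Y /andP[/andP[YX /eqP Ya] le_a]; apply: P_Y.
have -> : F U = - c^-1 *: A + (c^-1 *: B + 0).
  by rewrite -eqAB scalerDr scalerA mulVr // scale1r addr0 scaleNr addrC addrK.
by apply: (PS) => //; apply: PS.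
Qed.

End QGarnir.

(** * Homomorphisms attached to the trivial double coset *)

Section TrivialDoubleCoset.
Local Open Scope ring_scope.
Variables (R : idomainType) (q : R) (r : nat) (H : hecke q r).
Implicit Types (u v w d e f : 'S_r) (h k : H) (la mu nu : composition r).

(** For an element of [W_mu W_la], the factorisation through [W_mu D_mu] has its
    second factor in [W_la]. *)
Lemma sum_young_mul (V : nmodType) (G : 'S_r -> V) la mu :
  \sum_(w in (young mu * young la)%g) G w =
  \sum_(u in young mu) \sum_(v in young la :&: mincoset mu) G (u * v)%g.
Proof.
pose A := finset.setX (young mu) (young la :&: mincoset mu).
pose h (p : 'S_r * 'S_r) := (p.1 * p.2)%g.
have h_inj : {in A &, injective h}.
  move=> [u v] [u' v']; rewrite !in_setX !in_setI /h /=.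
  move=> /andP[uY /andP[_ vD]] /andP[u'Y /andP[_ v'D]] uvE.
  by have [-> ->] := young_fact_uniq uY u'Y vD v'D uvE.
have -> : (young mu * young la)%g = h @: A.
  apply/setP => w; apply/mulsgP/imsetP => [[u v uY vY ->]|[[u v]]].
    have [u' [d [u'Y dD vE u'la]]] := young_fact mu v.
    exists (u * u', d)%g; last by rewrite /h /= -mulgA -vE.
    rewrite in_setX in_setI youngM // dD andbT /=.
    by rewrite -(mulKg u' d) -vE youngM ?youngV ?u'la.
  by rewrite in_setX in_setI /h /= => /andP[uY /andP[vY _]] ->; exists u v.
rewrite big_imset // pair_big_dep /=; apply: eq_bigl => -[u v].
by rewrite in_setX.
Qed.

(** The inverses [u^-1] are the minimal representatives of the cosets [u W_la] in
    [W_mu W_la], so that left multiplication by this element is [phi_1]. *)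
Definition merge_elt mu la : H := \sum_(u in young mu :&: mincoset la) T H u^-1%g.

Lemma young_mul_sum_left la mu :
  \sum_(w in (young mu * young la)%g) T H w = merge_elt mu la * xla H la.
Proof.
rewrite (reindex_inj invg_inj) /=.
have -> : \sum_(w | (w^-1)%g \in (young mu * young la)%g) T H w^-1%g =
    \sum_(w in (young la * young mu)%g) T H w^-1%g.
  apply: eq_bigl => w; apply/mulsgP/mulsgP => -[u v uY vY wE].
    by exists v^-1%g u^-1%g; rewrite ?youngV // -invMg -wE invgK.
  by exists v^-1%g u^-1%g; rewrite ?youngV // -invMg -wE.
rewrite sum_young_mul exchange_big /merge_elt mulr_suml; apply: eq_bigr => u.
rewrite in_setI => /andP[_ /mincosetP uD].
rewrite /xla mulr_sumr [RHS](reindex_inj invg_inj) /=; apply: eq_big => [v|v vY].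
  by rewrite youngV.
rewrite T_mul; first by rewrite invMg.
by rewrite -invMg !ninvV addnC (young_inc_ninv vY uD).
Qed.

Lemma young_mul_sum_right la mu :
  rideal_pred (xla H mu) (\sum_(w in (young mu * young la)%g) T H w).
Proof.
apply/asboolP; exists (\sum_(v in young la :&: mincoset mu) T H v).
rewrite sum_young_mul /xla mulr_suml; apply: eq_bigr => u uY.
rewrite mulr_sumr; apply: eq_bigr => v; rewrite in_setI => /andP[_ /mincosetP vD].
by rewrite T_mul // (young_inc_ninv uY vD).
Qed.

Lemma merge_subproof la mu (m : Mperm H la) :
  rideal_pred (xla H mu) (merge_elt mu la * rideal_val m).
Proof.
have /asboolP[h ->] := rideal_valP m; rewrite mulrA -young_mul_sum_left.
by have /asboolP[k ->] := young_mul_sum_right la mu; apply/asboolP; exists (k * h);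
  rewrite mulrA.
Qed.

Definition merge_fun la mu (m : Mperm H la) : Mperm H mu :=
  MkRideal (merge_subproof mu m).

Lemma merge_linear la mu : linear_pred (@merge_fun la mu).
Proof.
apply/asboolP => a m n; apply/val_inj => /=.
by rewrite mulrDr -scalerAr.
Qed.

Lemma merge_hlinear la mu : hlinear_pred (MkHomR (merge_linear la mu)).
Proof. by apply/asboolP => m h; apply/val_inj; rewrite /= mulrA. Qed.

Lemma phi1E la mu (m : Mperm H la) :
  rideal_val (phi H mu la 1%g m) = merge_elt mu la * rideal_val m.
Proof.
have phiP : rideal_val (phi H mu la 1%g (rideal_gen (xla H la) 1)) =
    \sum_(w in (young mu * young la)%g) T H w.
  rewrite -[young mu in RHS]rcoset1.
  rewrite /phi; case: classical_sets.xgetP => [f _ fP|no]; first exact: fP.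
  case: (no (MkHomH (merge_hlinear la mu))).
  by rewrite /classical_sets.mkset /= mulr1 rcoset1 -young_mul_sum_left.
have /asboolP[h mE] := rideal_valP m.
have -> : m = rideal_act (rideal_gen (xla H la) 1) h.
  by apply/val_inj; rewrite /= mulr1.
have /asboolP-> : hlinear_pred (HomH_val (phi H mu la 1%g)) by case: (phi _ _ _ _).
by rewrite /= phiP young_mul_sum_left mulr1 mulrA.
Qed.

Lemma blk_dominated la mu (k : 'I_r) : dominated la mu -> (blk mu k <= blk la k)%N.
Proof.
move=> dom; rewrite leqNgt; apply/negP => /(psum_mono mu).
by have := blk_bounds la k; have := blk_bounds mu k; have := dom (blk la k).+1; lia.
Qed.

Lemma phi1_upper la mu : dominated la mu -> upper_pred (phi H mu la 1%g).
Proof.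
move=> dom; apply/asboolP; exists 1%N, (fun=> 1), (fun=> phi H mu la 1%g).
rewrite big_ord1 scale1r; split=> // _; exists 1%g => //=.
rewrite inE in_setI mincoset1 inE invg1 mincoset1 /=; apply/forallP => i.
apply/subsetP => _ /imsetP[k + ->]; rewrite perm1 mem_block => /eqP ki.
apply/bigcupP; exists (Ordinal (blk_size la k)); last by rewrite mem_block.
by rewrite /= -ki blk_dominated.
Qed.

Lemma range_d1 la mu (f : HomH H la mu) (e : C0 H mu) :
  sdominated la mu -> upper_pred f -> exists c, d1 H la c = HomR_comp e f.
Proof.
move=> /asboolP la_mu f_upper; pose g : chain1 la := MkChain1 la_mu.
pose x : Mchain1 H g := tensor_pure (MkHomU f_upper : HomU H la g) e.
pose c0 : Defs.dprod (@Mchain1 _ _ _ H la) := dfwith (fun=> 0) x.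
have c0E g' : g' \notin [:: g] -> c0 g' = 0.
  by rewrite inE eq_sym => gg'; rewrite /c0 dfwith_out.
have c0P : dsum_pred c0.
  apply/asboolP/(cardinality.sub_finite_set _ (cardinality.finite_seq [:: g])).
  by move=> g' /= cg'; apply: contraT => /c0E c0g'; rewrite c0g' eqxx in cg'.
exists (MkDsum c0P); rewrite (@d1E _ _ _ _ _ _ [:: g]) //.
rewrite big_seq1 /= /c0 dfwith_in /d1_chain tensor_lift_pure //.
exact: d1_chain_bilinear.
Qed.

(** Indexing the dual basis by row words allows a tableau to be changed one entry at
    a time; a word whose content is not [la] gives 0. *)
Definition eps_word la (rho : {ffun 'I_r -> nat}) : C0 H la :=
  \sum_(f in mincoset la | roww la f == rho) eps H la f.

Lemma eps_word_roww la d : d \in mincoset la -> eps_word la (roww la d) = eps H la d.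
Proof.
move=> dD; rewrite /eps_word (big_pred1 d) // => f /=; apply/andP/eqP => [[fD /eqP]|->//].
exact: roww_inj.
Qed.

Hypothesis q_unit : q \is a GRing.unit.

(** The coefficient of [T_e] in [T_(u^-1) T_(v f)] is read off with the trace, which
    replaces left multiplication by [T_(u^-1)] with [T_u T_e = T_(u e)]. *)
Lemma eps_phi1 la mu e : e \in mincoset mu ->
  HomR_comp (eps H mu e) (phi H mu la 1%g) =
  \sum_(u in young mu :&: mincoset la)
     q ^+ ninv u *: eps_word la (roww la (u * e)).
Proof.
move=> eD; rewrite (HomR_eps q_unit (HomR_comp _ _)).
under [RHS]eq_bigr => u _ do rewrite /eps_word big_mkcondr scaler_sumr.
rewrite exchange_big; apply: eq_bigr => f fD.
transitivity ((\sum_(u in young mu :&: mincoset la)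
    if roww la f == roww la (u * e) then q ^+ ninv u else 0) *: eps H la f).
  congr (_ *: _); rewrite /= epsE // phi1E /= /merge_elt mulr_suml linear_sum.
  apply: eq_bigr => u; rewrite in_setI => /andP[uY uD] /=.
  rewrite xla_Tmin // mulr_sumr linear_sum.
  have ueE := young_inc_ninv uY (mincosetP _ _ eD).
  under eq_bigr => v _ do rewrite /= (coef_TVT _ q_unit _ ueE).
  case: eqP => [/roww_eqP ufY|ne].
    rewrite (bigD1 (u * e * f^-1)%g) //= mulgKV eqxx big1 ?addr0 // => v /andP[_ vne].
    by case: eqP => // vfE; rewrite -vfE mulgK eqxx in vne.
  rewrite big1 // => v vY; case: eqP => // vfE; case: ne.
  by rewrite -vfE roww_young.
rewrite scaler_suml; apply: eq_bigr => u _; case: eqP => _ //.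
by rewrite scale0r scaler0.
Qed.

End TrivialDoubleCoset.

(** * Moving boxes up by one row *)

Section MoveUp.
Variable r : nat.
Implicit Types (u v w d e : 'S_r) (la mu : composition r).

Definition split_rows (i : nat) (rho : {ffun 'I_r -> nat}) (Y : {set 'I_r}) :
  {ffun 'I_r -> nat} :=
  [ffun x => if x \in Y then i
    else if (rho x == i) || (rho x == i.+1) then i.+1 else rho x].

Lemma ex_moved la i k : k <= part la i.+1 ->
  exists mu, forall c, psum mu c = psum la c + (c == i.+1) * k.
Proof.
move=> le_k; pose f c := (part la c + (c == i) * k - (c == i.+1) * k)%N.
have sum_f n : (\sum_(c < n) f c = psum la n + (n == i.+1) * k)%N.
  elim: n => [|n ih]; first by rewrite big_ord0 psum0.
  rewrite big_ord_recr /= ih psumS /f eqSS.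
  by case: (eqVneq n i.+1) => [->|ni]; rewrite ?(gtn_eqF (ltnSn i)) //=; lia.
pose n := (size la + i.+2)%N.
have [|mu muE] := @ex_composition r (mkseq f n).
  rewrite sumnE big_map -[n]subn0 -/(index_iota 0 n) big_mkord sum_f psum_size.
    by rewrite /n; case: eqP; lia.
  by rewrite /n; lia.
exists mu => m; rewrite -sum_f /psum; apply: eq_bigr => c _; rewrite muE.
have [lt_n|ge_n] := ltnP c n; first by rewrite nth_mkseq.
rewrite nth_default ?size_mkseq // /f part_size; last by rewrite /n in ge_n; lia.
by rewrite /n in ge_n; do 2!case: eqP => /=; lia.
Qed.

(** The hypotheses make [A] and [B] initial parts of one another, so that one of
    them contains the other and the cardinalities decide. *)
Lemma eq_initial (A B : {set 'I_r}) : #|A| = #|B| ->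
  (forall z z', z \in A -> z' \in B -> z' < z -> z' \in A) ->
  (forall z z', z \in A -> z' \in B -> z < z' -> z \in B) -> A = B.
Proof.
move=> eqAB A_down B_down; apply/eqP; rewrite eqEcard eqAB leqnn andbT.
apply: contraT => /subsetPn[z zA zB]; have BA : B \subset A.
  apply/subsetP => z' z'B; case: (ltngtP z' z) => [|lt_z|/val_inj eqz].
  - exact: A_down.
  - by have := B_down z z' zA z'B lt_z; rewrite (negbTE zB).
  by rewrite -eqz z'B in zB.
have /proper_card : B \proper A by apply/properP; split=> //; exists z.
by rewrite eqAB ltnn.
Qed.

Section Moved.
Variables (la mu : composition r) (i k : nat).
Hypothesis k_le : k <= part la i.+1.
Hypothesis psum_mu : forall c, psum mu c = psum la c + (c == i.+1) * k.

Lemma part_moved c :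
  part mu c = (part la c + (c == i) * k - (c == i.+1) * k)%N.
Proof.
have := psum_mu c.+1; have := psum_mu c; rewrite !psumS eqSS.
by case: (eqVneq c i) => ?; case: (eqVneq c i.+1) => ? /=; lia.
Qed.

Lemma moved_dominated : dominated la mu.
Proof. by move=> e; rewrite psum_mu leq_addr. Qed.

Lemma moved_sdominated : 0 < k -> sdominated la mu.
Proof.
move=> k_gt0; split; first exact: moved_dominated.
by move=> eq_la; have := psum_mu i.+1; rewrite -eq_la eqxx; lia.
Qed.

(** Block [i] of [mu] consists of block [i] of [la] and the first [k] positions of
    the next one. *)
Lemma blk_moved (x : 'I_r) :
  blk mu x = blk la x \/ blk la x = i.+1 /\ blk mu x = i.
Proof.
have /andP[ge lt] := blk_bounds la x.
have [lai|ne_i1] := eqVneq (blk la x) i.+1; last first.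
  left; apply/eqP; rewrite blkP !psum_mu (negbTE ne_i1); lia.
rewrite lai in ge lt *.
have [lt_x|ge_x] := ltnP x (psum la i.+1 + k).
  right; split=> //; apply/eqP; rewrite blkP !psum_mu eqxx.
  by rewrite (ltn_eqF (ltnSn i)) /=; have := psum_mono la (leqnSn i); lia.
left; apply/eqP; rewrite blkP !psum_mu eqxx (gtn_eqF (ltnSn i.+1)) /=; lia.
Qed.

Lemma blk_moved_i (x : 'I_r) : blk la x = i -> blk mu x = i.
Proof. by case: (blk_moved x) => [->//|[-> _] /esym/n_Sn[]]. Qed.

Variable e : 'S_r.
Hypothesis eD : e \in mincoset mu.

Let X : {set 'I_r} := [set x | roww mu e x == i].
Let rho := split_rows i (roww mu e).
Let K := young mu :&: mincoset la.
Let row_i (u : 'S_r) : {set 'I_r} := [set x | roww la (u * e) x == i].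

Lemma roww_moved u : u \in young mu -> roww la (u * e) = rho (row_i u).
Proof.
move=> /youngP uY; apply/ffunP => x; rewrite [RHS]ffunE inE.
case: eqP => [//|ne]; move: ne; rewrite !ffunE invMg permM.
set y := (e^-1 x)%g; set z := (u^-1 y)%g => ne.
have <- : blk mu z = blk mu y by rewrite -[in RHS](permKV u y) uY.
case: (blk_moved z) => [->|[-> ->]]; last by rewrite eqxx.
by rewrite (negbTE (introN eqP ne)) /=; case: eqP.
Qed.

Lemma row_i_inj : {in K &, injective row_i}.
Proof.
move=> u u'; rewrite !in_setI => /andP[uY uD] /andP[u'Y u'D] huE.
have /roww_eqP : roww la (u * e) = roww la (u' * e) by rewrite !roww_moved ?huE.
rewrite invMg mulgA mulgK => Y.
by have [] := young_fact_uniq Y (young1 la) uD u'D; rewrite ?mul1g ?mulgKV.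
Qed.

Lemma mem_row_X u (x : 'I_r) : u \in young mu ->
  (x \in X) = (blk mu ((u * e)^-1 x)%g == i).
Proof.
by move=> /youngP uY; rewrite inE ffunE invMg permM -[in RHS]uY permKV.
Qed.

Lemma row_i_image :
  row_i @: K = [set Y : {set 'I_r} | (Y \subset X) && (#|Y| == part la i)].
Proof.
apply/setP => Y; rewrite inE; apply/imsetP/andP => [[u]|[YX /eqP Ya]].
  rewrite in_setI => /andP[uY uD] ->; rewrite card_roww; split=> //.
  apply/subsetP => x; rewrite (mem_row_X _ uY) inE ffunE => /eqP.
  by move/blk_moved_i => ->.
have X_card : #|X| = (part la i + k)%N.
  by rewrite card_roww part_moved eqxx (ltn_eqF (ltnSn i)) /=; lia.
have YcE x : x \in Y -> roww mu e x = i.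
  by move/(subsetP YX); rewrite inE => /eqP.
have Y_other x : x \notin Y -> (rho Y x == i) = false.
  move=> xY; rewrite ffunE (negbTE xY); case: ifP => [_|/norP[/negbTE//]].
  exact: gtn_eqF.
have [u uD uE] : exists2 u, u \in mincoset la & roww la u =1 rho Y \o e.
  apply: ex_roww => c; pose A := [set x | rho Y x == c].
  have -> : [set x | (rho Y \o e) x == c] = e @^-1: A by apply/setP => x; rewrite !inE.
  rewrite -(card_imset _ (@perm_inj _ e)).
  have -> : e @: (e @^-1: A) = A.
    apply/setP => x; rewrite -[x](permKV e) (mem_imset _ _ (@perm_inj _ e)) inE //.
  have [ci|ne_i] := eqVneq c i.
    rewrite ci -Ya; apply: eq_card => x; rewrite inE ci.
    by have [xY|/Y_other] := boolP (x \in Y); [rewrite ffunE xY eqxx|].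
  have [c_i1|ne_i1] := eqVneq c i.+1.
    have -> : A = (X :\: Y) :|: [set x | roww mu e x == i.+1].
      apply/setP => x; rewrite !inE c_i1 [rho _ _]ffunE.
      have [xY|xY] := boolP (x \in Y).
        by rewrite (YcE _ xY) (ltn_eqF (ltnSn i)).
      case: (eqVneq (roww mu e x) i) => [_|_] /=; first by rewrite eqxx.
      by case: (eqVneq (roww mu e x) i.+1) => [_|/negbTE//]; rewrite eqxx.
    rewrite cardsU (_ : _ :&: _ = set0) ?cards0 ?subn0; last first.
      apply/setP => x; rewrite !inE; case: (x \in Y) => //=.
      by case: eqP => //= ->; rewrite (ltn_eqF (ltnSn i)).
    rewrite cardsD (setIidPr YX) X_card Ya card_roww part_moved c_i1 eqxx.
    by rewrite (gtn_eqF (ltnSn i)) /=; lia.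
  have -> : A = [set x | roww mu e x == c].
    apply/setP => x; rewrite !inE [rho _ _]ffunE; case: ifP => [xY|_].
      by rewrite (YcE _ xY).
    case: ifP => // /orP[/eqP->|/eqP->]; last by [].
    by rewrite eq_sym (negbTE ne_i1) eq_sym (negbTE ne_i).
  by rewrite card_roww part_moved (negbTE ne_i) (negbTE ne_i1) /= addn0 subn0.
have blkE z : blk la z = rho Y (e (u z)) by rewrite -(roww_perm la u) uE.
have blk_uE z : blk mu (u z) = roww mu e (e (u z)) by rewrite roww_perm.
(* In row [i + 1] both [u] and the identity send an initial part of the row into
   block [i] of [mu], and both parts have [k] elements. *)
pose A := [set z | (blk la z == i.+1) && (blk mu (u z) == i)].
pose B := [set z | (blk la z == i.+1) && (blk mu z == i)].
have row_i1 z : blk la z = i.+1 -> roww mu e (e (u z)) = i \/ roww mu e (e (u z)) = i.+1.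
  rewrite blkE [rho _ _]ffunE; case: ifP => [_ /n_Sn[]|_].
  by case: ifP => [/orP[]/eqP-> _|_ ->]; [left|right|right].
have mu_i1 z : blk la z = i.+1 -> blk mu z = i \/ blk mu z = i.+1.
  by case: (blk_moved z) => [->|[_ ->]]; [right|left].
have A_card : #|A| = k.
  rewrite -(card_imset _ (@perm_inj _ (u * e)%g)).
  have -> : (u * e)%g @: A = X :\: Y.
    apply/setP => x; rewrite -[x](permKV (u * e)%g) (mem_imset _ _ (@perm_inj _ _)).
    set z := ((u * e)^-1 x)%g; rewrite permM !inE blk_uE blkE [rho _ _]ffunE.
    have [xY|xY] := boolP (_ \in Y); first by rewrite (ltn_eqF (ltnSn i)).
    by case: (eqVneq (roww mu e _) i) => [->|]; rewrite ?eqxx ?andbF.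
  by rewrite cardsD (setIidPr YX) X_card Ya; lia.
have B_card : #|B| = k.
  have -> : B = block mu i :\: block la i.
    apply/setP => z; rewrite in_setD !mem_block inE.
    case: (blk_moved z) => [->|[-> ->]]; last by rewrite eqxx (gtn_eqF (ltnSn i)).
    by case: (eqVneq (blk la z) i) => [->|_]; rewrite ?(ltn_eqF (ltnSn i)) ?andbF.
  rewrite cardsD (setIidPr _) ?card_block ?part_moved; last first.
    by apply/subsetP => z; rewrite !mem_block => /eqP/blk_moved_i ->.
  by rewrite eqxx (ltn_eqF (ltnSn i)) /=; lia.
have AB : A = B.
  apply: eq_initial => [|z z'|z z']; first by rewrite A_card.
    rewrite !inE => /andP[/eqP za /eqP zu] /andP[/eqP z'a _] lt_z.
    rewrite z'a eqxx /=; have lt_u : u z' < u z.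
      by apply: (mincosetP _ _ uD) => //; rewrite za.
    have := blk_mono mu (ltnW lt_u); rewrite zu.
    by have := row_i1 _ z'a; rewrite -blk_uE; case=> -> //; rewrite ltnn.
  rewrite !inE => /andP[/eqP za _] /andP[_ /eqP z'b] lt_z.
  rewrite za eqxx /=; have := blk_mono mu (ltnW lt_z); rewrite z'b.
  by have := mu_i1 _ za; case=> -> //; rewrite ltnn.
have uY : u \in young mu.
  apply/youngP => z; have [z_i1|ne_i1] := eqVneq (blk la z) i.+1.
    have /setP/(_ z) := AB; rewrite !inE z_i1 eqxx /= blk_uE.
    by have [->|->] := mu_i1 _ z_i1; have [->|->] := row_i1 _ z_i1;
      rewrite ?eqxx ?(gtn_eqF (ltnSn i)).
  have -> : blk mu z = blk la z.
    by case: (blk_moved z) => // -[z_i1]; rewrite z_i1 eqxx in ne_i1.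
  rewrite blk_uE; move: ne_i1; rewrite blkE [rho _ _]ffunE.
  by case: ifP => [/YcE//|_]; case: ifP; rewrite ?eqxx.
exists u; first by rewrite in_setI uY.
apply/setP => x; rewrite inE ffunE invMg permM -(ffunE (fun x => blk la (u^-1%g x))).
rewrite [finfun _ _](uE _) /= permKV.
by have [xY|/Y_other->//] := boolP (x \in Y); rewrite ffunE xY eqxx.
Qed.

(** The inversions of [u] are the pairs [v < y] with [y] in [row_i u] and [v] in [X]
    outside [row_i u], carried back by [u * e]. *)
Lemma weight_row_i (R : idomainType) (q : R) u : u \in K ->
  weight q (row_i u) X = (q ^+ ninv u)%R.
Proof.
rewrite in_setI => /andP[uY /mincosetP uD]; move/youngP: (uY) => uP.
have e_inc := mincosetP _ _ eD.
rewrite /weight -expr_sum; congr (_ ^+ _)%R.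
rewrite /ninv exchange_big big_mkcond (reindex_inj (@perm_inj _ (u * e)%g)) /=.
apply: eq_bigr => b _; rewrite in_setD (mem_row_X _ uY) permK [_ \in row_i u]inE roww_perm.
have -> : (if (blk la b != i) && (blk mu b == i) then above (row_i u) ((u * e)%g b) else 0) =
    \sum_(a < r) [&& blk la b != i, blk mu b == i, blk la a == i & (u * e)%g b < (u * e)%g a].
  case: ifP => [/andP[-> ->]|bN]; last first.
    by rewrite big1 // => a _; case: (blk la b != i) bN => //= ->.
  rewrite /above -sum1_card big_mkcond (reindex_inj (@perm_inj _ (u * e)%g)) /=.
  by apply: eq_bigr => a _; rewrite !inE roww_perm; case: (_ && _).
apply: eq_bigr => a _; rewrite !permM; congr nat_of_bool.
apply/and4P/andP => [[lb mb la_i lt_e]|[lt_ab lt_u]].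
  have lb1 : blk la b = i.+1.
    by case: (blk_moved b) lb mb => [->|[-> _]//]; case: eqP.
  have ma := blk_moved_i (eqP la_i).
  split; first by apply: (@blk_lt _ la); rewrite lb1 (eqP la_i).
  rewrite ltnNge leq_eqVlt; apply/negP => /orP[/eqP/val_inj eq_u|lt_u].
    by rewrite eq_u ltnn in lt_e.
  have := e_inc _ _ lt_u; rewrite !uP ma (eqP mb) => /(_ erefl).
  by rewrite ltnNge ltnW.
have m_ab : blk mu a = blk mu b.
  have := blk_mono mu (ltnW lt_ab); have := blk_mono mu (ltnW lt_u).
  by rewrite !uP; lia.
have l_ab : blk la a < blk la b.
  rewrite ltn_neqAle blk_mono ?andbT 1?ltnW //; apply/eqP => eq_ab.
  by have := uD _ _ lt_ab eq_ab; rewrite ltnNge ltnW.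
have [la_i mb lb] : [/\ blk la a = i, blk mu b = i & blk la b = i.+1].
  case: (blk_moved a) (blk_moved b) => [aE|[aE ma]] [bE|[bE mb]].
  - by move: l_ab; rewrite -aE -bE m_ab ltnn.
  - by rewrite -aE m_ab.
  - move: l_ab; rewrite aE -bE -m_ab ma; lia.
  by move: l_ab; rewrite aE bE ltnn.
rewrite lb mb la_i (gtn_eqF (ltnSn i)) eqxx; split=> //.
by apply: e_inc => //; rewrite !uP.
Qed.

End Moved.

Local Open Scope ring_scope.

(** A [subset_sum] over a set [X] larger than row [i] is the image under [d_1] of
    [phi_1 (x) eps_e], where [t^mu e] has row [i] equal to [X]. *)
Lemma subset_sum_range (R : idomainType) (q : R) (H : hecke q r) la mu i k e :
    q \is a GRing.unit -> (0 < k <= part la i.+1)%N ->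
    (forall c, psum mu c = psum la c + (c == i.+1) * k)%N -> e \in mincoset mu ->
  exists c, d1 H la c = subset_sum q
    (fun Y => eps_word H la (split_rows i (roww mu e) Y))
    (part la i) [set x | roww mu e x == i].
Proof.
move=> q_unit /andP[k_gt0 k_le] muE eD.
have la_mu := moved_sdominated k_le muE k_gt0.
have [c cE] := range_d1 (eps H mu e) la_mu (phi1_upper H (proj1 la_mu)).
exists c; rewrite cE eps_phi1 // /subset_sum.
set X := [set x | _]; rewrite [RHS](eq_bigl (fun Y => Y \in
  [set Y : {set 'I_r} | (Y \subset X) && (#|Y| == part la i)])) => [|Y]; last by rewrite inE.
rewrite -(row_i_image k_le muE eD) big_imset /=; last exact: (row_i_inj k_le muE).
apply: eq_bigr => u uK; rewrite (weight_row_i k_le muE eD) //; congr (_ *: eps_word _ _ _).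
by apply: (roww_moved k_le muE); move: uK; rewrite in_setI => /andP[].
Qed.

End MoveUp.

(** * Straightening *)

Section Straightening.
Variable r : nat.
Implicit Types (d f : 'S_r) (la mu : composition r) (rho : {ffun 'I_r -> nat}).

Lemma box_inj la (b b' : box la) : brow b = brow b' -> bcol b = bcol b' -> b = b'.
Proof.
case: b b' => [c j] [c' j']; rewrite /brow /bcol /= => /val_inj cc'.
by case: _ / cc' j' => j' /val_inj->.
Qed.

Lemma pos_inj la (x y : 'I_r) : blk la x = blk la y -> tcol la x = tcol la y -> x = y.
Proof. by move=> b c; apply/val_inj; rewrite /= -(blk_col la x) -(blk_col la y) b c. Qed.

Lemma row_col_lt la d (x y : 'I_r) : d \in mincoset la ->
  blk la x = blk la y -> tcol la x < tcol la y -> d x < d y.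
Proof.
move=> /mincosetP dD b c; apply: dD => //.
by have := blk_col la x; have := blk_col la y; rewrite b; lia.
Qed.

(** When row [i] is shorter than row [i + 1], the column [c] just beyond its end
    leaves nothing to compare. Otherwise, without a violation each entry of row
    [i + 1] exceeds some entry of row [i] weakly to its right, hence the entry above
    it, and an induction down the columns makes [t^la d] standard. *)
Lemma nonstandard_violation la d : d \in mincoset la ->
    ~~ standard (tab_act (canon_tab la) d) ->
  exists i c, c < part la i.+1 /\ forall x y : 'I_r, blk la x = i -> c <= tcol la x ->
    blk la y = i.+1 -> tcol la y = c -> d y < d x.
Proof.
move=> dD d_nst; have [la_part|/partitionP la_npart] := boolP (is_partition la); last first.
  apply: contrapT => no; apply: la_npart => i; rewrite leqNgt; apply/negP => lt_part.
  apply: no; exists i, (part la i); split=> // x y bx; rewrite leqNgt.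
  by rewrite -bx col_lt.
apply: contrapT => no; move/negP: d_nst; apply.
have step x y : blk la y = (blk la x).+1 -> tcol la y = tcol la x -> d x < d y.
  move=> b c; have xy : x != y.
    by apply: contra_eq_neq b => ->; rewrite (ltn_eqF (ltnSn _)).
  rewrite perm_neq_lt //; apply/negP => lt_d; apply: no.
  exists (blk la x), (tcol la x); split=> [|x' y' bx']; first by rewrite -b -c col_lt.
  rewrite leq_eqVlt -b -c => /orP[/eqP cx|lt_c] by' cy'.
    have -> : x' = x by exact: (pos_inj bx' (etrans (esym cx) c)).
    by rewrite (pos_inj by' cy').
  rewrite (pos_inj by' cy') (ltn_trans lt_d) // (row_col_lt dD) ?bx' //.
  by rewrite -c.
have col_inc x y : blk la x < blk la y -> tcol la x = tcol la y -> d x < d y.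
  have [n] := ubnP (blk la y - blk la x); elim: n y => // n ih y le_n lt_b c.
  have lt_c : tcol la y < part la (blk la y).-1.
    exact: leq_trans (col_lt la y) (partition_mono la_part (leq_pred _)).
  have [z [bz cz _]] := ex_box lt_c.
  have lt_z : d z < d y by apply: step; rewrite ?cz // bz prednK //; lia.
  have [eq_b|ne_b] := eqVneq (blk la x) (blk la z).
    by rewrite (pos_inj eq_b) // cz.
  by apply: ltn_trans lt_z; apply: ih; rewrite ?cz //; lia.
apply/and3P; split=> //; last first.
  apply/forallP => b; apply/forallP => b'; apply/implyP => /andP[/eqP].
  have [-> ->] := box_ofE b; have [-> ->] := box_ofE b' => c lt_b.
  by rewrite [tab_act _ _ b]ffunE [tab_act _ _ b']ffunE col_inc.
apply/andP; split.
  apply/andP; split.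
    apply/injectiveP => b b'; rewrite !ffunE => /perm_inj/(congr1 val)/= E.
    have [bE cE] := box_ofE b; have [bE' cE'] := box_ofE b'.
    have tE : canon_tab la b = canon_tab la b' by apply/val_inj; rewrite !ffunE.
    by apply: box_inj; rewrite ?bE ?bE' ?cE ?cE' tE.
  apply/forallP => k; apply/codomP; exists (box_of la (d^-1%g k)).
  by rewrite tab_box_of permKV.
apply/forallP => b; apply/forallP => b'; apply/implyP => /andP[/eqP].
have [-> ->] := box_ofE b; have [-> ->] := box_ofE b' => eq_b lt_c.
by rewrite [tab_act _ _ b]ffunE [tab_act _ _ b']ffunE (row_col_lt dD).
Qed.

(** Powers of 2 let one large entry that moves down a row outweigh all the smaller
    entries that move up. *)
Definition measure rho : nat := \sum_(x < r) rho x * 2 ^ x.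

Lemma sum_pow2 n : \sum_(x < n) 2 ^ x < 2 ^ n.
Proof.
elim: n => [|n ih]; first by rewrite big_ord0.
by rewrite big_ord_recr expnS mul2n -addnn /= ltn_add2r.
Qed.

Lemma measure_split_rows i rho (Y : {set 'I_r}) (w : 'I_r) :
    rho w = i -> w \notin Y ->
    (forall x, x \in Y -> rho x != i -> rho x = i.+1 /\ x < w) ->
  measure rho < measure (split_rows i rho Y).
Proof.
move=> wi wY YP; pose B x := (x \in Y) && (rho x != i); pose C x := (x \notin Y) && (rho x == i).
have B_lt : \sum_(x < r) B x * 2 ^ x < 2 ^ w.
  apply: leq_ltn_trans (sum_pow2 w).
  rewrite (bigID (fun x : 'I_r => x < w)) /= [X in _ + X]big1 => [|x xw].
    by rewrite addn0 (big_ord_narrow (ltnW (ltn_ord w))); apply: leq_sum => x _;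
      rewrite -[leqRHS]mul1n leq_mul2r leq_b1 orbT.
  by case E: (B x) => //; have /andP[/YP xP /xP[_]] := E; rewrite (negbTE xw).
have C_ge : 2 ^ w <= \sum_(x < r) C x * 2 ^ x.
  by rewrite (bigD1 w) //= {1}/C wY wi eqxx mul1n leq_addr.
suff : measure (split_rows i rho Y) + \sum_(x < r) B x * 2 ^ x =
    measure rho + \sum_(x < r) C x * 2 ^ x by lia.
rewrite /measure -!big_split; apply: eq_bigr => x _; rewrite /= -!mulnDl; congr (_ * _).
rewrite ffunE /B /C; case: (boolP (x \in Y)) => [xY|xY] /=.
  by have [->//|/(YP _ xY)[-> _]] := eqVneq (rho x) i; rewrite ?addn0 ?addn1.
case: (eqVneq (rho x) i) => [->|_] /=; first by rewrite addn0 addn1.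
by case: (eqVneq (rho x) i.+1) => [->|_].
Qed.

Lemma split_rowsK i rho (X Y : {set 'I_r}) :
  (forall x, x \in X -> (rho x == i) || (rho x == i.+1)) ->
  split_rows i (split_rows i rho X) Y = split_rows i rho Y.
Proof.
move=> XP; apply/ffunP => x; rewrite !ffunE; case: (x \in Y) => //.
case: (boolP (x \in X)) => [/XP->|_]; first by rewrite eqxx.
case E: ((rho x == i) || (rho x == i.+1)); first by rewrite eqxx orbT.
by rewrite E.
Qed.

Lemma split_rows_id i rho : split_rows i rho [set x | rho x == i] = rho.
Proof.
by apply/ffunP => x; rewrite ffunE inE; case: (eqVneq (rho x) i) => [->|_] //=; case: eqP => [->|].
Qed.

Lemma split_rows_eq_i i rho X x : (split_rows i rho X x == i) = (x \in X).
Proof.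
rewrite ffunE; case: (x \in X); first by rewrite eqxx.
case: ifP => [_|/norP[/negbTE//]]; exact: gtn_eqF.
Qed.

(** This makes [split_rows i (roww la d) X] the row word of a row-standard tableau
    of the shape [mu] in which [k] boxes have moved up from row [i + 1]. *)
Lemma card_split_rows la mu d i k (X : {set 'I_r}) c : k <= part la i.+1 ->
    (forall c, psum mu c = psum la c + (c == i.+1) * k) ->
    (forall x, x \in X -> (roww la d x == i) || (roww la d x == i.+1)) ->
    #|X| = part la i + k ->
  #|[set x | split_rows i (roww la d) X x == c]| = part mu c.
Proof.
move=> k_le muE XP X_card; rewrite (part_moved k_le muE).
set rho := roww la d in XP *.
have [->|ne_i] := eqVneq c i.
  rewrite (ltn_eqF (ltnSn i)) mul1n mul0n subn0 -X_card.
  by apply: eq_card => x; rewrite inE split_rows_eq_i.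
have [->|ne_i1] := eqVneq c i.+1.
  have -> : [set x | split_rows i rho X x == i.+1] =
      ([set x | rho x == i] :|: [set x | rho x == i.+1]) :\: X.
    apply/setP => x; rewrite !inE ffunE; case: (boolP (x \in X)) => /= _.
      by rewrite (ltn_eqF (ltnSn i)).
    by case: ifP => [_|/norP[_ /negbTE]//]; rewrite eqxx.
  rewrite cardsD (setIidPr _); last by apply/subsetP => x /XP; rewrite !inE.
  rewrite cardsU (_ : _ :&: _ = set0) ?cards0 ?subn0; last first.
    apply/setP => x; rewrite !inE; case: eqP => //= ->.
    by rewrite (ltn_eqF (ltnSn i)).
  by rewrite !card_roww X_card mul0n mul1n; lia.
rewrite !mul0n addn0 subn0 -(card_roww la d); apply: eq_card => x.
rewrite !inE ffunE; case: (boolP (x \in X)) => [/XP xi|_].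
  rewrite eq_sym (negbTE ne_i).
  by case/orP: xi => /eqP->; rewrite eq_sym ?(negbTE ne_i) ?(negbTE ne_i1).
case: ifP => // xi; rewrite eq_sym (negbTE ne_i1).
by case/orP: xi => /eqP->; rewrite eq_sym ?(negbTE ne_i) ?(negbTE ne_i1).
Qed.

End Straightening.

Section Exactness.
Local Open Scope ring_scope.
Variables (R : idomainType) (q : R) (r : nat) (H : hecke q r).
Hypothesis q_unit : q \is a GRing.unit.
Implicit Types (d f : 'S_r) (la mu : composition r).

Definition d1_plus_K0 la (e : C0 H la) : Prop :=
  exists c b, K0 H la b /\ e = d1 H la c + b.

Lemma K0_0 la : K0 H la 0.
Proof. exact: Rspan_0. Qed.

Lemma d1_plus_K0_comb la (a : R) (e f : C0 H la) : d1_plus_K0 e ->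
  d1_plus_K0 f -> d1_plus_K0 (a *: e + f).
Proof.
move=> [c [b [bK ->]]] [c' [b' [b'K ->]]]; exists (a *: c + c'), (a *: b + b').
by split; [exact: Rspan_comb | rewrite linearP scalerDr addrACA].
Qed.

Lemma d1_plus_K0_0 la : d1_plus_K0 (0 : C0 H la).
Proof. by exists 0, 0; split; [exact: K0_0 | rewrite linear0 addr0]. Qed.

Lemma range_d1_plus_K0 la c : d1_plus_K0 (d1 H la c).
Proof. by exists c, 0; split; [exact: K0_0 | rewrite addr0]. Qed.

(** For a violation in column [c], the relation of [garnir_span] is applied to the
    set [U] of entries of row [i] and to the first [c + 1] entries [Z] of row [i + 1].
    Modulo the image of [d_1] it rewrites the tableau by tableaux in which an entry of
    [U] beyond all of [Z] has moved down, hence by tableaux of larger measure. *)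
Lemma eps_straighten la d : d \in mincoset la -> d1_plus_K0 (eps H la d).
Proof.
pose N := (\sum_(x < r) size la * 2 ^ x)%N.
have [n] := ubnP (N - measure (roww la d)); elim: n d => // n ih d le_n dD.
have [d_st|d_nst] := boolP (standard (tab_act (canon_tab la) d)).
  exists 0, (eps H la d); rewrite linear0 add0r; split=> //.
  by apply: Rspan_mem; exists (tab_act (canon_tab la) d), d.
have [i [c [c_lt viol]]] := nonstandard_violation dD d_nst.
set rho := roww la d in le_n *.
pose U := [set x | rho x == i].
pose Z := [set x | (rho x == i.+1) && (tcol la (d^-1%g x) <= c)%N].
have [y [yb yc yE]] := ex_box c_lt; pose top := d y.
have U_card : #|U| = part la i by apply: card_roww.
have Z_card : #|Z| = c.+1.
  pose A := [set k : 'I_r | (psum la i.+1 <= k < psum la i.+1 + c.+1)%N].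
  rewrite (_ : Z = d @: A).
    rewrite card_imset; last exact: perm_inj.
    by apply: card_interval; have := psum_le la i.+2; rewrite psumS; lia.
  apply/setP => x; rewrite -[x](permKV d) (mem_imset _ _ (@perm_inj _ d)) inE.
  rewrite roww_perm permK inE; set z := (d^-1 x)%g.
  apply/andP/andP => [[/eqP bz le_c]|[ge lt]].
    by have := blk_col la z; rewrite bz; lia.
  have bz : blk la z = i.+1 by apply/eqP; rewrite blkP; have := psumS la i.+1; lia.
  by have := blk_col la z; rewrite bz; split; lia.
have topZ : top \in Z by rewrite inE roww_perm permK yb yc eqxx /=.
have top_max : {in Z, forall z : 'I_r, (z <= top)%N}.
  move=> x; rewrite inE -[x](permKV d) roww_perm permK; set z := (d^-1 x)%g.
  move=> /andP[/eqP bz]; rewrite -yc leq_eqVlt => /orP[/eqP cz|lt_z].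
    by rewrite (pos_inj (etrans bz (esym yb)) cz).
  by apply/ltnW/(row_col_lt dD); rewrite ?bz ?yb.
have UZ : [disjoint U & Z].
  rewrite -setI_eq0; apply/eqP/setP => x; rewrite !inE; case: eqP => //= ->.
  by rewrite (ltn_eqF (ltnSn i)).
have above_U : (part la i < above U top + #|Z|)%N.
  rewrite Z_card addnS ltnS addnC -leq_subLR.
  pose A := [set k : 'I_r | (psum la i + c <= k < psum la i + c + (part la i - c))%N].
  have [c_le|c_gt] := leqP c (part la i); last by lia.
  have <- : #|A| = (part la i - c)%N.
    by apply: card_interval; have := psum_le la i.+1; rewrite psumS; lia.
  rewrite -(card_imset _ (@perm_inj _ d)); apply/subset_leq_card/subsetP => _ /imsetP[k + ->].
  rewrite !inE roww_perm => /andP[ge lt].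
  have bk : blk la k = i by apply/eqP; rewrite blkP; have := psumS la i; lia.
  rewrite bk eqxx /=; apply: viol => //.
  by have := blk_col la k; rewrite bk; lia.
have UZ_rows x : x \in U :|: Z -> (rho x == i) || (rho x == i.+1).
  by rewrite !inE => /orP[->//|/andP[->]]; rewrite orbT.
pose F (Y : {set 'I_r}) := eps_word H la (split_rows i rho Y).
have -> : eps H la d = F U by rewrite /F split_rows_id eps_word_roww.
apply: (garnir_span q_unit (P := @d1_plus_K0 la) (d1_plus_K0_0 la)
  (@d1_plus_K0_comb la) UZ topZ top_max) => [S SZ|Y YX Y_card le_a].
  pose k := (#|Z| - #|S|)%N; pose X := (U :|: Z) :\: S.
  have S_lt := proper_card SZ; have S_sub := proper_sub SZ.
  have X_card : #|X| = (part la i + k)%N.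
    rewrite /X cardsD (setIidPr _); last by rewrite (subset_trans S_sub) ?subsetUr.
    rewrite cardsU (eqP (_ : U :&: Z == set0)) ?setI_eq0 //.
    by rewrite cards0 subn0 U_card /k addnBA // ltnW.
  have k_bound : (0 < k <= part la i.+1)%N by rewrite /k Z_card in S_lt *; lia.
  have /andP[_ k_le] := k_bound.
  have X_rows x : x \in X -> (rho x == i) || (rho x == i.+1).
    by rewrite inE => /andP[_ /UZ_rows].
  have [mu muE] := ex_moved k_le.
  have [e eD eE] := ex_roww (fun m => card_split_rows m k_le muE X_rows X_card).
  have := subset_sum_range H q_unit k_bound muE eD.
  have -> : roww mu e = split_rows i rho X by apply/ffunP.
  rewrite (_ : [set x | _] = X); last by apply/setP => x; rewrite inE split_rows_eq_i.
  rewrite U_card => -[c' c'E]; rewrite -/X.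
  have -> : subset_sum q F (part la i) X = d1 H la c'.
    by rewrite c'E; apply: eq_bigr => Y _; rewrite /F split_rowsK.
  exact: range_d1_plus_K0.
rewrite /F; case: (pickP (fun f => (f \in mincoset la) && (roww la f == split_rows i rho Y)))
    => [f /andP[fD /eqP fE]|no]; last first.
  by rewrite /eps_word big_pred0 //; apply: d1_plus_K0_0.
rewrite -fE eps_word_roww //; apply: ih => //; rewrite fE.
have [w wU lt_w] : exists2 w, w \in U & (w \notin Y) && (top < w)%N.
  have : ~~ ([set y in U | (top < y)%N] \subset [set y in Y | (top < y)%N]).
    apply/negP => /subset_leq_card; rewrite -/(above U top) -/(above Y top).
    by rewrite leqNgt -(ltn_add2r #|Z|) (leq_ltn_trans le_a) // U_card.
  move/subsetPn => [w]; rewrite !inE => /andP[wU lt_w].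
  by rewrite lt_w andbT => wY; exists w; rewrite ?inE ?wY.
have lt_m : (measure rho < measure (split_rows i rho Y))%N.
  move: wU lt_w; rewrite inE => /eqP wi /andP[wY lt_w].
  apply: (measure_split_rows wi wY) => x xY xi; have := subsetP YX x xY.
  rewrite !inE (negbTE xi) /= => /andP[/eqP x1 le_x]; split=> //.
  by apply: leq_ltn_trans lt_w; apply: top_max; rewrite inE x1 eqxx.
have m_le : (measure (split_rows i rho Y) <= N)%N.
  rewrite -fE; apply: leq_sum => x _; rewrite leq_mul2r ffunE ltnW ?orbT //.
  exact: blk_size.
by lia.
Qed.

Lemma d1_plus_K0T la (e : C0 H la) : d1_plus_K0 e.
Proof.
rewrite (HomR_eps q_unit e); elim/big_rec: _ => [|d e' dD e'P]; first exact: d1_plus_K0_0.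
by apply: d1_plus_K0_comb => //; apply: eps_straighten.
Qed.

End Exactness.

Import classical_sets.
Local Open Scope ring_scope.
Local Open Scope classical_set_scope.

Theorem theorem4p4 (R : idomainType) (q : R) (hq : q \is a GRing.unit)
    (r : nat) (hr : (0 < r)%N) (H : hecke q r) (la : composition r) :
  [/\ [set a + b | a in range (d1 H la) & b in K0 H la] = [set: C0 H la],
      d0 H la @^-1` [set 0] `&` K0 H la = [set 0]
    & range (d1 H la) = d0 H la @^-1` [set 0]].
Proof.
split.
- apply/seteqP; split=> // e _; have [c [b [bK ->]]] := d1_plus_K0T hq e.
  by exists (d1 H la c); [exists c | exists b].
- apply/seteqP; split=> [e [/= e0 eK]|_ ->]; first exact: (K0_ker hq).
  by split; [rewrite /= linear0 | apply: K0_0].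
apply/seteqP; split=> [_ [c _ <-]|e /= e0]; first exact: d1_d0.
have [c [b [bK eE]]] := d1_plus_K0T hq e.
have b0 : d0 H la b = 0.
  by move: e0; rewrite eE linearD /= d1_d0 // add0r.
by exists c => //; rewrite eE (K0_ker hq bK b0) addr0.
Qed.
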